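(* Let $D$ be a non-commutative division ring with center $F$, and let $M$ be a non-abelian locally solvable maximal subgroup of $D^*$. If the derived subgroup $M'$ of $M$ is algebraic over $F$, then $[D:F]<\infty$.
   Context: $D^*$ is the multiplicative group of $D$; a maximal subgroup of $D^*$ is a proper subgroup not contained in any other proper subgroup. A group is locally solvable if every finitely generated subgroup is solvable. A subset of $D$ is algebraic over $F$ if each of its elements is algebraic over $F$. $M'$ denotes the derived (commutator) subgroup of $M$. *)

(* Defs.v *)
From HB Require Import structures.
From mathcomp Require Import all_boot all_order all_algebra.
Set Implicit Arguments. Unset Strict Implicit. Unset Printing Implicit Defensive.
Import GRing.Theory.
Local Open Scope ring_scope.

Section DivRingDefs.
Variable D : unitRingType.

Definition is_division_ring : Prop := forall x : D, x != 0 -> x \is a GRing.unit.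

Definition noncommutative : Prop := exists x y : D, x * y != y * x.

Definition center (x : D) : Prop := forall y : D, x * y = y * x.

Definition units_set (x : D) : Prop := x \is a GRing.unit.

Definition is_subgroup (H : D -> Prop) : Prop :=
  [/\ forall x, H x -> x \is a GRing.unit,
      H 1,
      forall x y, H x -> H y -> H (x * y)
    & forall x, H x -> H x^-1].

Definition gen (S : D -> Prop) (x : D) : Prop :=
  forall H, is_subgroup H -> (forall y, S y -> H y) -> H x.

Definition commutator (x y : D) : D := x^-1 * y^-1 * x * y.

Definition derived (H : D -> Prop) : D -> Prop :=
  gen (fun z => exists x y, [/\ H x, H y & z = commutator x y]).

Fixpoint derived_iter (n : nat) (H : D -> Prop) : D -> Prop :=
  if n is n'.+1 then derived (derived_iter n' H) else H.

Definition solvable_grp (H : D -> Prop) : Prop :=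
  exists n, forall x, derived_iter n H x -> x = 1.

Definition locally_solvable (M : D -> Prop) : Prop :=
  forall s : seq D, (forall x, x \in s -> M x) -> solvable_grp (gen (fun x => x \in s)).

Definition nonabelian (M : D -> Prop) : Prop :=
  exists x y, [/\ M x, M y & x * y != y * x].

Definition maximal_subgroup (M : D -> Prop) : Prop :=
  [/\ is_subgroup M,
      exists x, units_set x /\ ~ M x
    & forall H, is_subgroup H -> (forall x, M x -> H x) ->
        (forall x, H x -> M x) \/ (forall x, units_set x -> H x)].

Definition algebraic_over_center (x : D) : Prop :=
  exists p : {poly D}, [/\ p != 0, forall i, center p`_i & p.[x] = 0].

Definition set_algebraic_over_center (S : D -> Prop) : Prop :=
  forall x, S x -> algebraic_over_center x.

Definition finite_dim_over_center : Prop :=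
  exists s : seq D, forall x : D, exists c : seq D,
    (forall i, center c`_i) /\ x = \sum_(i < size s) c`_i * s`_i.

End DivRingDefs.

(* Main.v *)
(** Write [F] for the center of [D] and [F(N)] for the division subring generated by [N]. By
    maximality and Cartan-Brauer-Hua, a division subring normalized by [M] is [D], lies in [F],
    or has its nonzero elements in [M]; in the last case it is commutative. If [M] has a
    noncentral abelian normal subgroup, it has one containing an algebraic noncentral element [a];
    the centralizer [C] of the finite orbit [a^M] is then a field, [M / C] acts on it as a finite
    group with fixed field [F], and a Galois argument bounds the dimension of [D] over [F].

    Otherwise every normal subgroup [N] of [M] is central or has [F(N) = D]. Let [J] be a finite
    subset of [M'] and [X] its normal closure, and suppose the third derived subgroup [X3] of [X]
    noncentral. Then [J] lies in [F(X3)], and this remains true when [M] is replaced by a finitely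
    generated, hence solvable, subgroup [H]; whatever centralizes one of the first three derived
    subgroups of [X] therefore centralizes [X]. By independence of automorphisms, [X] centralizes
    each of its abelian [H]-normal subgroups, so its last nonabelian derived subgroup [Y] has
    class two. As a power of each [y] in [Y] is central in [Y], the quotients [h y h^-1 y^-1] with
    [h] in [X] are torsion. If the torsion subgroup of [Y] is abelian, [X'] centralizes [Y], and so
    does [X]. If not, it contains a quaternion group whose axes [X] permutes, and [X3], hence [X],
    centralizes that group. Both are absurd, so [M] is solvable. The same torsion argument, applied
    to the last noncentral derived subgroup of [M], yields a quaternion group whose axes [M]
    permutes, and [D] is its span over [F].

    The second half, applied to the nonzero elements of a division subring contained in [M], also
    gives the commutativity claimed above: conjugation by [2 + s] does not preserve the quaternion
    group generated by [s] and [t]. *)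

From mathcomp Require Import all_boot all_order all_algebra.
From mathcomp Require Import fingroup perm cyclic alt boolp.
Require Import Defs.
Set Implicit Arguments. Unset Strict Implicit. Unset Printing Implicit Defensive.
Import GRing.Theory.
Local Open Scope ring_scope.

(** * Conjugation, centralizers and division subrings *)

Definition conjr (D : unitRingType) (g x : D) : D := g * x * g^-1.

Definition cent (D : unitRingType) (S : D -> Prop) (x : D) : Prop :=
  forall y, S y -> x * y = y * x.

Definition normalized_by (D : unitRingType) (G S : D -> Prop) : Prop :=
  forall g x, G g -> S x -> S (conjr g x).

Definition abelian_set (D : unitRingType) (S : D -> Prop) : Prop :=
  forall x y, S x -> S y -> x * y = y * x.

(** Containing the center makes [dgen S] the division subring [F(S)]. Since [0^-1 = 0], closure
    under inverses can be asked of every element. *)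
Definition division_subring (D : unitRingType) (R : D -> Prop) : Prop :=
  [/\ forall x, center x -> R x,
      forall x y, R x -> R y -> R (x + y),
      forall x, R x -> R (- x),
      forall x y, R x -> R y -> R (x * y)
    & forall x, R x -> R x^-1].

Definition dgen (D : unitRingType) (S : D -> Prop) (x : D) : Prop :=
  forall R, division_subring R -> (forall y, S y -> R y) -> R x.

Section DivisionRing.
Variables (D : unitRingType) (hD : is_division_ring D).
Implicit Types (x y z g h : D) (S T G H R : D -> Prop).

Lemma unitr_neq0 x : x \is a GRing.unit -> x != 0.
Proof. by apply: contraTneq => ->; rewrite unitr0. Qed.

Lemma mulr_neq0 x y : x != 0 -> y != 0 -> x * y != 0.
Proof. by move=> /hD Ux /hD Uy; apply: unitr_neq0; rewrite unitrMl. Qed.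

Lemma mulr_eq0P x y : x * y = 0 -> x = 0 \/ y = 0.
Proof.
move=> xy0; case: (eqVneq x 0) => [|x0]; first by left.
case: (eqVneq y 0) => [|y0]; first by right.
by have := mulr_neq0 x0 y0; rewrite xy0 eqxx.
Qed.

Lemma conjr1 x : conjr 1 x = x.
Proof. by rewrite /conjr mul1r invr1 mulr1. Qed.

Lemma conjrD g x y : conjr g (x + y) = conjr g x + conjr g y.
Proof. by rewrite /conjr mulrDr mulrDl. Qed.

Lemma conjrN g x : conjr g (- x) = - conjr g x.
Proof. by rewrite /conjr mulrN mulNr. Qed.

Lemma conjr0 g : conjr g 0 = 0.
Proof. by rewrite /conjr mulr0 mul0r. Qed.

Lemma conjr_sum g I (r : seq I) (P : pred I) F :
  conjr g (\sum_(i <- r | P i) F i) = \sum_(i <- r | P i) conjr g (F i).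
Proof. by rewrite /conjr mulr_sumr mulr_suml. Qed.

Lemma conjrM g x y : g \is a GRing.unit -> conjr g (x * y) = conjr g x * conjr g y.
Proof. by move=> Ug; rewrite /conjr -!mulrA; do 2!congr (_ * _); rewrite mulKr. Qed.

Lemma conjr_id g : g \is a GRing.unit -> conjr g 1 = 1.
Proof. by move=> Ug; rewrite /conjr mulr1 divrr. Qed.

Lemma conjrX g x n : g \is a GRing.unit -> conjr g (x ^+ n) = conjr g x ^+ n.
Proof.
move=> Ug; elim: n => [|n IHn]; first by rewrite !expr0 conjr_id.
by rewrite !exprS conjrM // IHn.
Qed.

Lemma conjr_comp g h x : g \is a GRing.unit -> h \is a GRing.unit ->
  conjr (g * h) x = conjr g (conjr h x).
Proof. by move=> Ug Uh; rewrite /conjr invrM // !mulrA. Qed.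

Lemma conjrK g x : g \is a GRing.unit -> conjr g^-1 (conjr g x) = x.
Proof. by move=> Ug; rewrite -conjr_comp ?unitrV // mulVr // conjr1. Qed.

Lemma conjrKV g x : g \is a GRing.unit -> conjr g (conjr g^-1 x) = x.
Proof. by move=> Ug; rewrite -conjr_comp ?unitrV // mulrV // conjr1. Qed.

Lemma conjr_inj g x y : g \is a GRing.unit -> conjr g x = conjr g y -> x = y.
Proof. by move=> Ug e; rewrite -(conjrK x Ug) e conjrK. Qed.

Lemma unitr_conj g x : g \is a GRing.unit -> x \is a GRing.unit ->
  conjr g x \is a GRing.unit.
Proof. by move=> Ug Ux; rewrite /conjr !unitrMl ?unitrV. Qed.

Lemma conjrV g x : g \is a GRing.unit -> conjr g x^-1 = (conjr g x)^-1.
Proof.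
move=> Ug; case: (eqVneq x 0) => [->|/hD Ux]; first by rewrite invr0 conjr0 invr0.
by rewrite /conjr !invrM ?unitrMl ?unitrV // invrK mulrA.
Qed.

Lemma conjr_fixP g x : g \is a GRing.unit -> conjr g x = x <-> g * x = x * g.
Proof.
move=> Ug; rewrite /conjr; split=> [e|->]; last by rewrite mulrK.
by rewrite -{2}e divrK.
Qed.

Lemma conjr_commutator g x y : g \is a GRing.unit ->
  conjr g (commutator x y) = commutator (conjr g x) (conjr g y).
Proof. by move=> Ug; rewrite /commutator !conjrM // !conjrV. Qed.

(** * Subgroups *)

Lemma subgroup_unit H x : is_subgroup H -> H x -> x \is a GRing.unit.
Proof. by case=> h _ _ _; apply: h. Qed.

Lemma subgroup1 H : is_subgroup H -> H 1.
Proof. by case. Qed.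

Lemma subgroupM H x y : is_subgroup H -> H x -> H y -> H (x * y).
Proof. by case=> _ _ h _; apply: h. Qed.

Lemma subgroupV H x : is_subgroup H -> H x -> H x^-1.
Proof. by case=> _ _ _ h; apply: h. Qed.

Lemma subgroupX H x n : is_subgroup H -> H x -> H (x ^+ n).
Proof.
move=> sH Hx; elim: n => [|n IHn]; first exact: subgroup1.
by rewrite exprS; apply: subgroupM.
Qed.

Lemma subgroup_conj H g x : is_subgroup H -> H g -> H x -> H (conjr g x).
Proof. by move=> sH Hg Hx; do !apply: subgroupM => //; apply: subgroupV. Qed.

Lemma subgroup_commutator H x y : is_subgroup H -> H x -> H y -> H (commutator x y).
Proof. by move=> sH Hx Hy; do !apply: subgroupM => //; apply: subgroupV. Qed.

Lemma units_subgroup : is_subgroup (@units_set D).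
Proof.
split=> //; [exact: unitr1 | by move=> x y Ux Uy; rewrite /units_set unitrMl |].
by move=> x Ux; rewrite /units_set unitrV.
Qed.

Lemma gen_sub S x : S x -> gen S x.
Proof. by move=> Sx H sH; apply. Qed.

Lemma gen_subgroup S : (forall x, S x -> x \is a GRing.unit) -> is_subgroup (gen S).
Proof.
move=> US; split=> [x|H sH _|x y Hx Hy H sH SH|x Hx H sH SH].
- by move/(_ _ units_subgroup); apply.
- exact: subgroup1.
- by apply: subgroupM => //; [apply: Hx | apply: Hy].
- by apply: subgroupV => //; apply: Hx.
Qed.

Lemma gen_le S H x : is_subgroup H -> (forall y, S y -> H y) -> gen S x -> H x.
Proof. by move=> sH SH; apply. Qed.

Lemma gen_mono S T x : (forall y, S y -> T y) -> gen S x -> gen T x.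
Proof. by move=> ST Sx H sH TH; apply: Sx => // y /ST /TH. Qed.

Lemma gen_conj S g : g \is a GRing.unit -> (forall x, S x -> S (conjr g x)) ->
  forall x, gen S x -> gen S (conjr g x).
Proof.
move=> Ug nS x Sx H sH SH; suff [] : x \is a GRing.unit /\ H (conjr g x) by [].
apply: (Sx (fun x => x \is a GRing.unit /\ H (conjr g x))) => [|y Sy].
  split=> [y []|||] //; first by split; [exact: unitr1 | rewrite conjr_id //; apply: subgroup1].
    by move=> y z [Uy Hy] [Uz Hz]; split; [rewrite unitrMl | rewrite conjrM //; apply: subgroupM].
  by move=> y [Uy Hy]; split; [rewrite unitrV | rewrite conjrV //; apply: subgroupV].
have Hy := SH _ (nS _ Sy); split=> //.
by rewrite -(conjrK y Ug); apply: unitr_conj; rewrite ?unitrV //; apply: subgroup_unit Hy.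
Qed.

Lemma derived_subgroup H : is_subgroup H -> is_subgroup (derived H).
Proof.
move=> sH; apply: gen_subgroup => z [x [y [Hx Hy ->]]].
by apply: (subgroup_unit sH); apply: subgroup_commutator.
Qed.

Lemma derived_commutator H x y : H x -> H y -> derived H (commutator x y).
Proof. by move=> Hx Hy; apply: gen_sub; exists x, y. Qed.

Lemma derived_le H x : is_subgroup H -> derived H x -> H x.
Proof. by move=> sH; apply=> // _ [y [z [Hy Hz ->]]]; apply: subgroup_commutator. Qed.

Lemma derived_mono S T x : (forall y, S y -> T y) -> derived S x -> derived T x.
Proof. by move=> ST; apply: gen_mono => _ [y [z [/ST Ty /ST Tz ->]]]; exists y, z. Qed.

Lemma derived_iter_subgroup n H : is_subgroup H -> is_subgroup (derived_iter n H).
Proof. by move=> sH; elim: n => //= n; apply: derived_subgroup. Qed.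

Lemma derived_iter_mono n S T x :
  (forall y, S y -> T y) -> derived_iter n S x -> derived_iter n T x.
Proof. by move=> ST; elim: n x => [|n IHn] x /=; [apply: ST | apply: derived_mono]. Qed.

Lemma derived_iter_le m n H x : is_subgroup H ->
  derived_iter (m + n) H x -> derived_iter n H x.
Proof.
move=> sH; elim: m x => //= m IHm x /derived_le; rewrite -/derived_iter => h.
by apply: IHm; apply: h; apply: derived_iter_subgroup.
Qed.

Lemma derived_iterD m n H : derived_iter m (derived_iter n H) = derived_iter (m + n) H.
Proof. by elim: m => //= m ->. Qed.

Lemma derived_normalized G H : is_subgroup G -> normalized_by G H ->
  normalized_by G (derived H).
Proof.
move=> sG nH g x Gg; apply: gen_conj; first exact: subgroup_unit Gg.
move=> _ [y [z [Hy Hz ->]]]; rewrite conjr_commutator; last exact: subgroup_unit Gg.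
by exists (conjr g y), (conjr g z); split=> //; apply: nH.
Qed.

Lemma derived_iter_normalized n G H : is_subgroup G -> normalized_by G H ->
  normalized_by G (derived_iter n H).
Proof. by move=> sG nH; elim: n => //= n; apply: derived_normalized. Qed.

Lemma derived_iter_normal n G : is_subgroup G -> normalized_by G (derived_iter n G).
Proof. by move=> sG; apply: derived_iter_normalized => // g x; apply: subgroup_conj. Qed.

Lemma derived_trivial H : is_subgroup H -> abelian_set H -> forall x, derived H x -> x = 1.
Proof.
move=> sH cH x Hx; apply: (Hx (fun z => z = 1)) => [|_ [y [z [Hy Hz ->]]]].
  split=> [_ ->|//|_ _ -> ->|_ ->]; rewrite ?unitr1 ?mulr1 ?invr1 //.
have Uy := subgroup_unit sH Hy; have Uz := subgroup_unit sH Hz.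
by rewrite /commutator -!mulrA (cH _ _ Hy Hz) mulKr // mulVr.
Qed.

(** * Division subrings *)

Lemma cent_division_subring S : division_subring (cent S).
Proof.
split=> [x cx y _|x y cx cy z Sz|x cx z Sz|x y cx cy z Sz|x cx z Sz].
- exact: cx.
- by rewrite mulrDl mulrDr cx // cy.
- by rewrite mulNr mulrN cx.
- by rewrite -mulrA cy // mulrA cx // mulrA.
case: (eqVneq x 0) => [->|/hD Ux]; first by rewrite invr0 mul0r mulr0.
by apply: (mulrI Ux); rewrite mulVKr // mulrA cx // mulrK.
Qed.

Lemma setT_division_subring : division_subring (fun _ : D => True).
Proof. by []. Qed.

Lemma dgen_sub S x : S x -> dgen S x.
Proof. by move=> Sx R dR; apply. Qed.

Lemma dgen_division_subring S : division_subring (dgen S).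
Proof.
split=> [x cx R [h] // _ _ _ _ _|x y Sx Sy R dR SR|x Sx R dR SR|x y Sx Sy R dR SR|x Sx R dR SR];
  try exact: h.
- by case: (dR) => _ h _ _ _; apply: h; [apply: Sx | apply: Sy].
- by case: (dR) => _ _ h _ _; apply: h; apply: Sx.
- by case: (dR) => _ _ _ h _; apply: h; [apply: Sx | apply: Sy].
- by case: (dR) => _ _ _ _ h; apply: h; apply: Sx.
Qed.

Lemma dgen_mono S T x : (forall y, S y -> T y) -> dgen S x -> dgen T x.
Proof. by move=> ST Sx R dR TR; apply: Sx => // y /ST /TR. Qed.

Lemma dgen_le S R x : division_subring R -> (forall y, S y -> R y) -> dgen S x -> R x.
Proof. by move=> dR SR; apply. Qed.

Lemma cent_dgen S x : cent S x -> cent (dgen S) x.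
Proof.
move=> cx y Sy; apply/esym; apply: (Sy (cent (fun z => z = x))) => // [|z Sz _ ->].
  exact: cent_division_subring.
by rewrite cx.
Qed.

Lemma dgen_abelian S : abelian_set S -> abelian_set (dgen S).
Proof.
move=> cS x y Sx Sy; apply: (cent_dgen (S := S)) => // z Sz.
by apply/esym; apply: (cent_dgen (S := S)) => // w; apply: cS.
Qed.

Lemma divsub0 R : division_subring R -> R 0.
Proof. by case=> h _ _ _ _; apply: h => x; rewrite mul0r mulr0. Qed.

Lemma divsub1 R : division_subring R -> R 1.
Proof. by case=> h _ _ _ _; apply: h => x; rewrite mul1r mulr1. Qed.

Lemma divsub_center R x : division_subring R -> center x -> R x.
Proof. by case=> h _ _ _ _; apply: h. Qed.

Lemma divsubD R x y : division_subring R -> R x -> R y -> R (x + y).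
Proof. by case=> _ h _ _ _; apply: h. Qed.

Lemma divsubN R x : division_subring R -> R x -> R (- x).
Proof. by case=> _ _ h _ _; apply: h. Qed.

Lemma divsubB R x y : division_subring R -> R x -> R y -> R (x - y).
Proof. by move=> dR Rx Ry; apply: divsubD => //; apply: divsubN. Qed.

Lemma divsubM R x y : division_subring R -> R x -> R y -> R (x * y).
Proof. by case=> _ _ _ h _; apply: h. Qed.

Lemma divsubV R x : division_subring R -> R x -> R x^-1.
Proof. by case=> _ _ _ _ h; apply: h. Qed.

Lemma divsub_conj R g x : division_subring R -> R g -> R x -> R (conjr g x).
Proof. by move=> dR Rg Rx; do !apply: divsubM => //; apply: divsubV. Qed.

Lemma divsub_preim_conj R g : division_subring R -> g \is a GRing.unit ->
  division_subring (fun x => R (conjr g x)).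
Proof.
move=> dR Ug; split=> [x cx|x y|x|x y|x].
- by rewrite /conjr -cx mulrK //; apply: divsub_center.
- by rewrite conjrD; apply: divsubD.
- by rewrite conjrN; apply: divsubN.
- by rewrite conjrM //; apply: divsubM.
- by rewrite conjrV //; apply: divsubV.
Qed.

Lemma dgen_conj S g : g \is a GRing.unit -> (forall x, S x -> S (conjr g x)) ->
  forall x, dgen S x -> dgen S (conjr g x).
Proof.
move=> Ug nS x Sx; apply: (Sx (fun y => dgen S (conjr g y))) => [|y /nS]; last exact: dgen_sub.
by apply: divsub_preim_conj => //; apply: dgen_division_subring.
Qed.

Lemma dgen_normalized G S : is_subgroup G -> normalized_by G S -> normalized_by G (dgen S).
Proof.
move=> sG nS g x Gg; apply: dgen_conj; first exact: subgroup_unit Gg.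
by move=> y; apply: nS.
Qed.

Lemma cent_normalized G S : is_subgroup G -> normalized_by G S -> normalized_by G (cent S).
Proof.
move=> sG nS g x Gg cx y Sy; have Ug := subgroup_unit sG Gg.
rewrite -(conjrKV y Ug) -!conjrM // cx //.
by apply: nS => //; apply: subgroupV.
Qed.

Lemma nonzero_subgroup R : division_subring R -> is_subgroup (fun x => R x /\ x != 0).
Proof.
move=> dR; split=> [x [_ /hD] //||x y [Rx x0] [Ry y0]|x [Rx x0]].
- by split; [apply: divsub1 | apply: oner_neq0].
- by split; [apply: divsubM | apply: mulr_neq0].
- by split; [apply: divsubV | rewrite invr_eq0].
Qed.

Lemma gen_dgen S x : (forall y, S y -> y \is a GRing.unit) -> gen S x -> dgen S x.
Proof.
move=> US Sx; have [] : dgen S x /\ x != 0; last by [].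
apply: (gen_le (nonzero_subgroup (dgen_division_subring S))) Sx => y Sy.
by split; [apply: dgen_sub | apply: unitr_neq0; apply: US].
Qed.

(* If [r^a <> r] with [a] outside [R], compare the conjugates [r1] of [r] by [a] and
   [r2] by [a + 1]: [(r2 - r1) a = r - r2] would put [a] in [R]. *)
Lemma cartan_brauer_hua R E : division_subring R -> division_subring E ->
  (forall x, R x -> E x) ->
  (forall g x, E g -> g != 0 -> R x -> R (conjr g x)) ->
  (forall x, E x -> R x) \/ (forall x y, R x -> E y -> x * y = y * x).
Proof.
move=> dR dE RE nR.
have key a r : E a -> ~ R a -> R r -> r * a = a * r.
  move=> Ea nRa Rr; have a0 : a != 0 by apply: contra_not_neq nRa => ->; apply: divsub0.
  have a1 : a + 1 != 0.
    apply: contra_not_neq nRa => /eqP; rewrite addr_eq0 => /eqP ->.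
    by apply: divsubN => //; apply: divsub1.
  have Ea1 : E (a + 1) by apply: divsubD => //; apply: divsub1.
  have R1 := nR _ _ Ea a0 Rr; have R2 := nR _ _ Ea1 a1 Rr.
  have e1 : conjr a r * a = a * r by rewrite /conjr divrK // hD.
  have e2 : conjr (a + 1) r * (a + 1) = (a + 1) * r by rewrite /conjr divrK // hD.
  have e : (conjr (a + 1) r - conjr a r) * a = r - conjr (a + 1) r.
    move: e2; rewrite mulrBl e1 mulrDr mulr1 mulrDl mul1r => e2.
    by apply/eqP; rewrite subr_eq addrAC eq_sym subr_eq e2 addrC.
  case: (eqVneq (conjr (a + 1) r) (conjr a r)) => [e12|ne].
    move: e; rewrite e12 subrr mul0r => /esym/eqP; rewrite subr_eq0 => /eqP {1}->.
    by rewrite e1.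
  case: nRa; have Ud : conjr (a + 1) r - conjr a r \is a GRing.unit by rewrite hD ?subr_eq0.
  rewrite -(mulKr Ud a) e; apply: divsubM => //; last exact: divsubB.
  by apply: divsubV => //; apply: divsubB.
case: (EM (forall x, E x -> R x)) => [|/existsNP [a /not_implyP [Ea nRa]]]; [by left|].
right=> x y Rx Ey; case: (EM (R y)) => Ry; last exact: key.
(* For [y] in [R], both [a] and [a + y] lie outside [R], so [key] applies to each, and their
   difference is [y]. *)
have: x * (a + y) = (a + y) * x.
  apply: key => //; first exact: divsubD.
  by move=> Ray; apply: nRa; rewrite -(addrK y a); apply: divsubB.
by rewrite mulrDr mulrDl key // => /addrI.
Qed.

End DivisionRing.
(** * Passage to finitely generated subgroups *)

Definition normal_closure (D : unitRingType) (H J : D -> Prop) : D -> Prop :=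
  gen (fun z => exists h j, [/\ H h, J j & z = conjr h j]).

(** [P] is an operator on subgroups, such as [derived]. For monotone [P] the values at finitely
    generated subgroups of [G] form a directed family, which is why [gen], [derived] and [dgen] can
    be moved through this union. *)
Definition fg_witnessed (D : unitRingType) (G : D -> Prop)
    (P : (D -> Prop) -> D -> Prop) (z : D) : Prop :=
  exists s : seq D, (forall x, x \in s -> G x) /\ P (gen (fun x => x \in s)) z.

Definition monotone (D : unitRingType) (P : (D -> Prop) -> D -> Prop) : Prop :=
  forall S T x, (forall y, S y -> T y) -> P S x -> P T x.

Section FinitelyGenerated.
Variables (D : unitRingType) (hD : is_division_ring D).
Implicit Types (x y z g h : D) (S T G H J : D -> Prop) (P Q : (D -> Prop) -> D -> Prop).

Lemma fg_subgroup G (s : seq D) : is_subgroup G -> (forall x, x \in s -> G x) ->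
  is_subgroup (gen (fun x => x \in s)).
Proof. by move=> sG Gs; apply: gen_subgroup => x /Gs; apply: subgroup_unit. Qed.

Lemma fg_le G (s : seq D) : is_subgroup G -> (forall x, x \in s -> G x) ->
  forall x, gen (fun x => x \in s) x -> G x.
Proof. by move=> sG Gs x; apply. Qed.

(** The concatenated list of generators serves both memberships. The joint property ignores its
    point, so 1 is a placeholder. *)
Lemma fg_join G P Q z w : monotone P -> monotone Q ->
  fg_witnessed G P z -> fg_witnessed G Q w ->
  fg_witnessed G (fun H _ => P H z /\ Q H w) 1.
Proof.
move=> mP mQ [s [Gs Pz]] [t [Gt Qw]]; exists (s ++ t); split=> [x|].
  by rewrite mem_cat => /orP [/Gs|/Gt].
by split; [apply: mP Pz | apply: mQ Qw] => y; apply: gen_mono => u; rewrite mem_cat => ->;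
  rewrite ?orbT.
Qed.

Lemma fg_gen G P z : is_subgroup G -> monotone P ->
  (forall H x, is_subgroup H -> P H x -> x \is a GRing.unit) ->
  gen (fg_witnessed G P) z -> fg_witnessed G (fun H => gen (P H)) z.
Proof.
move=> sG mP UP; have mgP : monotone (fun H => gen (P H)).
  by move=> S T x ST; apply: gen_mono => y; apply: mP.
have sgP (s : seq D) : (forall x, x \in s -> G x) -> is_subgroup (gen (P (gen (fun x => x \in s)))).
  by move=> Gs; apply: gen_subgroup => y; apply: UP; apply: (fg_subgroup sG).
apply: gen_le => [|y [s [Gs Py]]]; last by exists s; split=> //=; apply: gen_sub.
split=> [x [s [Gs Px]]||x y wx wy|x [s [Gs Px]]].
- exact: subgroup_unit (sgP _ Gs) Px.
- by exists [::]; split=> //=; apply: subgroup1; apply: sgP.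
- have [s [Gs [Px Py]]] := fg_join mgP mgP wx wy.
  by exists s; split=> //; apply: (subgroupM (sgP _ Gs)).
- by exists s; split=> //; apply: (subgroupV (sgP _ Gs)).
Qed.

Lemma fg_derived G P z : is_subgroup G -> monotone P ->
  (forall H, is_subgroup H -> is_subgroup (P H)) ->
  derived (fg_witnessed G P) z -> fg_witnessed G (fun H => derived (P H)) z.
Proof.
move=> sG mP sP dz; apply: fg_gen => // [S T x ST [y [w [Py Pw ->]]]|H x sH [y [w [Py Pw ->]]]|].
- by exists y, w; split=> //; apply: mP ST _.
- by apply: (subgroup_unit (sP _ sH)); apply: subgroup_commutator => //; apply: sP.
apply: gen_mono dz => _ [y [w [wy ww ->]]].
have [s [Gs [Py Pw]]] := fg_join mP mP wy ww.
by exists s; split=> //; exists y, w.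
Qed.

Lemma fg_derived_iter n G P z : is_subgroup G -> monotone P ->
  (forall H, is_subgroup H -> is_subgroup (P H)) ->
  derived_iter n (fg_witnessed G P) z -> fg_witnessed G (fun H => derived_iter n (P H)) z.
Proof.
move=> sG mP sP; elim: n z => //= n IHn z dz; apply: fg_derived => //.
- by move=> S T x ST; apply: derived_iter_mono => y; apply: mP.
- by move=> H sH; apply: derived_iter_subgroup; apply: sP.
by apply: derived_mono dz.
Qed.

Lemma fg_dgen G P z : is_subgroup G -> monotone P ->
  dgen (fg_witnessed G P) z -> fg_witnessed G (fun H => dgen (P H)) z.
Proof.
move=> sG mP; have mdP : monotone (fun H => dgen (P H)).
  by move=> S T x ST; apply: dgen_mono => y; apply: mP.
have dP H : division_subring (dgen (P H)) by apply: dgen_division_subring.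
apply: dgen_le => [|y [s [Gs Py]]]; last by exists s; split=> //=; apply: dgen_sub.
split=> [x cx|x y wx wy|x [s [Gs Px]]|x y wx wy|x [s [Gs Px]]].
- by exists [::]; split=> //=; apply: divsub_center.
- have [s [Gs [Px Py]]] := fg_join mdP mdP wx wy.
  by exists s; split=> //; apply: (divsubD (dP _)).
- by exists s; split=> //; apply: (divsubN (dP _)).
- have [s [Gs [Px Py]]] := fg_join mdP mdP wx wy.
  by exists s; split=> //; apply: (divsubM (dP _)).
- by exists s; split=> //; apply: (divsubV (dP _)).
Qed.

Lemma fg_seq G P (J : seq D) : monotone P -> (forall j, j \in J -> fg_witnessed G P j) ->
  exists s : seq D, (forall x, x \in s -> G x) /\
    forall j, j \in J -> P (gen (fun x => x \in s)) j.
Proof.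
move=> mP; elim: J => [|j J IHJ] wJ; first by exists [::].
have [s [Gs Ps]] : fg_witnessed G (fun H _ => forall j, j \in J -> P H j) 1.
  by apply: IHJ => i iJ; apply: wJ; rewrite inE iJ orbT.
have [t [Gt [Pj PJ]]] : fg_witnessed G
    (fun H _ => P H j /\ forall j, j \in J -> P H j) 1.
  apply: (fg_join (Q := fun H _ => forall j, j \in J -> P H j) (w := 1) mP).
  - by move=> S T _ ST PS i iJ; apply: mP (PS _ iJ).
  - by apply: wJ; rewrite mem_head.
  - by exists s.
by exists t; split=> // i; rewrite inE => /orP [/eqP ->|/PJ].
Qed.

Lemma normal_closure_subgroup H J : is_subgroup H -> (forall j, J j -> j \is a GRing.unit) ->
  is_subgroup (normal_closure H J).
Proof.
move=> sH UJ; apply: gen_subgroup => _ [h [j [Hh Jj ->]]].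
by apply: unitr_conj; [apply: subgroup_unit Hh | apply: UJ].
Qed.

Lemma normal_closure_mono S T J x : (forall y, S y -> T y) ->
  normal_closure S J x -> normal_closure T J x.
Proof.
by move=> ST; apply: gen_mono => _ [h [j [Sh Jj ->]]]; exists h, j; split=> //; apply: ST.
Qed.

Lemma normal_closure_le H J G x : is_subgroup G -> (forall y, J y -> G y) ->
  normalized_by H G -> normal_closure H J x -> G x.
Proof. by move=> sG JG nG; apply=> // _ [h [j [Hh Jj ->]]]; apply: nG => //; apply: JG. Qed.

Lemma normal_closure_normalized H J : is_subgroup H -> normalized_by H (normal_closure H J).
Proof.
move=> sH g x Hg; have Ug := subgroup_unit sH Hg.
apply: gen_conj => // _ [h [j [Hh Jj ->]]]; exists (g * h), j; split=> //.
  exact: subgroupM.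
by rewrite conjr_comp //; apply: subgroup_unit Hh.
Qed.

Lemma normal_closure_sub H J x : is_subgroup H -> J x -> normal_closure H J x.
Proof.
move=> sH Jx; apply: gen_sub; exists 1, x; split=> //; first exact: subgroup1.
by rewrite conjr1.
Qed.

(** Membership in a derived subgroup of the normal closure involves only finitely many conjugators
    from [G]. *)
Lemma normal_closure_fg n G J z : is_subgroup G -> (forall j, J j -> j \is a GRing.unit) ->
  derived_iter n (normal_closure G J) z ->
  fg_witnessed G (fun H => derived_iter n (normal_closure H J)) z.
Proof.
move=> sG UJ dz; apply: fg_derived_iter => //.
- by move=> S T x; apply: normal_closure_mono.
- by move=> H sH; apply: normal_closure_subgroup.
apply: derived_iter_mono dz => x gx.
apply: (fg_gen (P := fun H z => exists h j, [/\ H h, J j & z = conjr h j])) => //.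
- by move=> S T y ST [h [j [Sh Jj ->]]]; exists h, j; split=> //; apply: ST.
- move=> H _ sH [h [j [Hh Jj ->]]]; apply: unitr_conj; [exact: subgroup_unit Hh | exact: UJ].
apply: gen_mono gx => _ [h [j [Gh Jj ->]]]; exists [:: h]; split=> [y|].
  by rewrite inE => /eqP ->.
by exists h, j; split=> //; apply: gen_sub; rewrite mem_head.
Qed.

End FinitelyGenerated.
(** * Finite orbits and independence of automorphisms *)

Section Orbits.
Variables (D : unitRingType) (hD : is_division_ring D).
Implicit Types (x y z g h : D) (S T G H J K : D -> Prop).

(** A polynomial over a division ring can have infinitely many roots, but distinct commuting roots
    have invertible differences and are counted as over a field. *)
Lemma commuting_roots_bound (p : {poly D}) (rs : seq D) :
  p != 0 -> uniq rs -> (forall x, x \in rs -> p.[x] = 0) ->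
  (forall x y, x \in rs -> y \in rs -> x * y = y * x) -> (size rs < size p)%N.
Proof.
move=> p0 Urs rsp crs; apply: max_ring_poly_roots => //.
  by apply/allP => x xrs; apply/rootP; apply: rsp.
elim: rs Urs {rsp} crs => //= x rs IHrs /andP [xrs Urs] crs; apply/andP; split; last first.
  by apply: IHrs => // y z yrs zrs; apply: crs; rewrite inE ?yrs ?zrs orbT.
apply/allP => y yrs; apply/andP; split.
  by apply/eqP; apply: crs; rewrite inE ?yrs ?eqxx ?orbT.
by apply: hD; rewrite subr_eq0; apply: contraNneq xrs => <-.
Qed.

Lemma conjr_root (p : {poly D}) g x : g \is a GRing.unit ->
  (forall i, center p`_i) -> p.[x] = 0 -> p.[conjr g x] = 0.
Proof.
move=> Ug cp px0; rewrite -(conjr0 g) -px0 !horner_coef conjr_sum.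
apply: eq_bigr => i _; rewrite conjrM // conjrX //; congr (_ * _).
by rewrite /conjr -cp mulrK.
Qed.

Lemma finite_enum (P : D -> Prop) n :
  (forall rs : seq D, uniq rs -> (forall x, x \in rs -> P x) -> (size rs <= n)%N) ->
  exists O : seq D, uniq O /\ forall x, x \in O <-> P x.
Proof.
move=> bP; apply: contrapT => nO.
have [rs [Urs Prs size_rs]] : exists rs : seq D,
    [/\ uniq rs, forall x, x \in rs -> P x & size rs = n.+1].
  elim: n.+1 => [|k [rs [Urs Prs size_rs]]]; first by exists [::].
  have [x Px xrs] : exists2 x, P x & x \notin rs.
    apply: contrapT => nx; apply: nO; exists rs; split=> // x; split; first exact: Prs.
    by move=> Px; apply: contrapT => /negP xrs; apply: nx; exists x.
  exists (x :: rs); split=> [|y|]; rewrite /= ?xrs ?size_rs //.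
  by rewrite inE => /orP [/eqP ->|/Prs].
by have := bP rs Urs Prs; rewrite size_rs ltnn.
Qed.

(** All conjugates of [a] are roots of one polynomial with central coefficients, and they commute by
    hypothesis. *)
Lemma finite_orbit G a : is_subgroup G -> algebraic_over_center a ->
  (forall g h, G g -> G h -> conjr g a * conjr h a = conjr h a * conjr g a) ->
  exists O : seq D, uniq O /\ forall x, x \in O <-> exists2 g, G g & x = conjr g a.
Proof.
move=> sG [p [p0 cp pa]] cG; apply: (finite_enum (n := size p)) => rs Urs Prs.
apply/ltnW/commuting_roots_bound => // [x /Prs [g Gg ->]|].
  by apply: conjr_root => //; apply: subgroup_unit Gg.
by move=> x y /Prs [g Gg ->] /Prs [h Gh ->]; apply: cG.
Qed.

(* The sums over [ws] are sums over the finite group of permutations of [O] induced by [G]. *)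
Lemma coset_representatives G (O : seq D) : is_subgroup G -> uniq O ->
  (forall g x, G g -> x \in O -> conjr g x \in O) ->
  exists ws : seq D, (forall w, w \in ws -> G w) /\
    forall phi : D -> D,
      (forall g h, G g -> G h -> {in O, conjr g =1 conjr h} -> phi g = phi h) ->
      (forall g, G g -> \sum_(w <- ws) phi (g * w) = \sum_(w <- ws) phi w) /\
      ((forall w, w \in ws -> ~ {in O, conjr w =1 id} -> phi w = 0) ->
       \sum_(w <- ws) phi w = phi 1).
Proof.
move=> sG UO nO; pose n := size O.
pose acts g (s : {perm 'I_n}) := forall i : 'I_n, conjr g O`_i = O`_(s i).
have acts_inO g s h t : acts g s -> acts h t -> {in O, conjr g =1 conjr h} <-> s = t.
  move=> gs ht; split=> [e|e x xO].
    apply/permP => i; apply/val_inj/eqP; rewrite -(nth_uniq 0 _ _ UO) ?ltn_ord //.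
    by rewrite -gs -ht e // mem_nth.
  have xn : (index x O < n)%N by rewrite index_mem.
  by have := gs (Ordinal xn); have := ht (Ordinal xn); rewrite /= nth_index // e => -> ->.
have actsE g : G g -> exists s, acts g s.
  move=> Gg; have lt_i (i : 'I_n) : (index (conjr g O`_i) O < n)%N.
    by rewrite index_mem nO // mem_nth.
  have inj_f : injective (fun i => Ordinal (lt_i i)).
    move=> i j [] e; have {e} : conjr g O`_i = conjr g O`_j.
      rewrite -(nth_index 0 (_ : conjr g O`_i \in O)) ?nO ?mem_nth // e.
      by rewrite nth_index // nO ?mem_nth.
    move/(conjr_inj (subgroup_unit sG Gg))/eqP.
    by rewrite nth_uniq ?ltn_ord // => /eqP /val_inj.
  by exists (perm inj_f) => i; rewrite permE /= nth_index // nO // mem_nth.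
have acts1 : acts 1 1%g by move=> i; rewrite conjr1 perm1.
have actsM g s h t : G g -> G h -> acts g s -> acts h t -> acts (h * g) (s * t)%g.
  by move=> Gg Gh gs ht i; rewrite conjr_comp ?gs ?ht ?permM //; apply: subgroup_unit sG _.
pose P s := exists2 g, G g & acts g s.
pose ch s := if pselect (P s) is left h then s2val (cid2 h) else 1.
have chP s : P s -> G (ch s) /\ acts (ch s) s.
  by rewrite /ch; case: pselect => // Ps _; case: (cid2 Ps).
exists [seq ch s | s <- enum {perm 'I_n} & `[< P s >]]; split=> [w|phi cphi].
  by case/mapP => s; rewrite mem_filter => /andP [/asboolP /chP [Gs _] _] ->.
have sumE F : \sum_(w <- [seq ch s | s <- enum {perm 'I_n} & `[< P s >]]) F w
    = \sum_(s | `[< P s >]) F (ch s) :> D.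
  by rewrite big_map big_filter big_enum_cond.
split=> [g Gg|phi0]; rewrite !sumE.
  (* Permutations compose from left to right: multiplying a representative by [g] on the left
     multiplies its permutation by [t] on the right. *)
  have [t gt] := actsE _ Gg; rewrite [RHS](reindex_inj (mulIg t)) /=.
  have PM s : `[< P (s * t)%g >] = `[< P s >].
    apply: asbool_equiv_eq; split=> [[h Gh hst]|[h Gh hs]]; last first.
      by exists (g * h); [apply: subgroupM | apply: actsM].
    have [u gVu] := actsE _ (subgroupV sG Gg).
    have tu : (t * u)%g = 1%g.
      apply/(acts_inO (g^-1 * g) _ 1 1%g) => //; first exact: actsM (subgroupV sG Gg) gt gVu.
      by move=> x _; rewrite mulVr //; apply: subgroup_unit Gg.
    exists (g^-1 * h); first by apply: subgroupM => //; apply: subgroupV.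
    have := actsM _ _ _ _ Gh (subgroupV sG Gg) hst gVu.
    by rewrite -mulgA tu mulg1.
  rewrite [RHS](eq_bigl _ _ PM); apply: eq_bigr => s /asboolP Ps.
  have [Gs as_] := chP _ Ps; have [|Gst ast] := chP (s * t)%g.
    by apply/asboolP; rewrite PM; apply/asboolP.
  apply: cphi => //; first exact: subgroupM.
  by apply/(acts_inO _ (s * t)%g _ (s * t)%g) => //; apply: actsM.
have P1 : P 1%g by exists 1 => //; apply: subgroup1.
have [G1 a1] := chP _ P1.
rewrite (bigD1 1%g) /=; last exact/asboolP.
rewrite big1 ?addr0 => [|s /andP [/asboolP Ps s1]].
  by apply: cphi => //; [exact: subgroup1 | apply/(acts_inO _ 1%g _ 1%g)].
have [Gs as_] := chP _ Ps; apply: phi0 => [|e].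
  by apply: map_f; rewrite mem_filter mem_enum andbT; apply/asboolP.
case/eqP: s1.
by apply/(acts_inO (ch s) _ 1) => // x xO; rewrite conjr1; apply: e.
Qed.

(* [sum l * k] with [sum (conjr u l) * k = 0]: the image of the product over [u] of
   [(l_u (x) 1 - 1 (x) u(l_u)) / (l_u - u(l_u))] in [K (x) K]. *)
Lemma dual_family K (us : seq D) : division_subring K -> abelian_set K ->
  (forall u x, u \in us -> K x -> K (conjr u x)) ->
  (forall u, u \in us -> u \is a GRing.unit) ->
  (forall u, u \in us -> exists2 l, K l & conjr u l != l) ->
  exists lk : seq (D * D),
    [/\ forall p, p \in lk -> K p.1 /\ K p.2,
        \sum_(p <- lk) p.1 * p.2 = 1
      & forall u, u \in us -> \sum_(p <- lk) conjr u p.1 * p.2 = 0].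
Proof.
move=> dK cK; elim: us => [|u us IHus] nK Uus mK.
  exists [:: (1, 1)]; split=> [p||//]; last by rewrite big_seq1 mulr1.
  by rewrite inE => /eqP -> /=; split; apply: divsub1.
have [lk [Klk lk1 lk0]] : exists lk : seq (D * D),
    [/\ forall p, p \in lk -> K p.1 /\ K p.2,
        \sum_(p <- lk) p.1 * p.2 = 1
      & forall u, u \in us -> \sum_(p <- lk) conjr u p.1 * p.2 = 0].
  by apply: IHus => [v x vus|v vus|v vus]; [apply: nK | apply: Uus | apply: mK];
    rewrite inE vus orbT.
have [l Kl ul] := mK u (mem_head _ _); have Kul := nK _ _ (mem_head _ _) Kl.
pose d := (l - conjr u l)^-1.
have Kd : K d by apply: divsubV => //; apply: divsubB.
exists ([seq (l * p.1, p.2 * d) | p <- lk] ++ [seq (p.1, - conjr u l * (p.2 * d)) | p <- lk]).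
(* The enlarged family multiplies the old sum at [v] by [(v(l) - u(l)) d], a factor that is 0 at
   [v = u] and 1 at [v = 1]. *)
have key v : (forall x, K x -> K (conjr v x)) -> v \is a GRing.unit ->
    \sum_(p <- [seq (l * p.1, p.2 * d) | p <- lk]
             ++ [seq (p.1, - conjr u l * (p.2 * d)) | p <- lk]) conjr v p.1 * p.2
    = (conjr v l - conjr u l) * (\sum_(p <- lk) conjr v p.1 * p.2) * d.
  move=> Kv Uv; rewrite big_cat !big_map /= -big_split /= mulr_sumr mulr_suml.
  rewrite big_seq [RHS]big_seq; apply: eq_bigr => p plk.
  have [Kp1 Kp2] := Klk p plk.
  rewrite conjrM // [X in _ + X]mulrA (cK (conjr v p.1) (- conjr u l)); last 2 first.
  - exact: Kv.
  - by apply: divsubN.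
  by rewrite mulrBl mulrBl !mulNr !mulrA.
split=> [p||v].
- rewrite mem_cat => /orP [] /mapP [q /Klk [Kq1 Kq2] ->] /=.
    by split; apply: divsubM.
  by split=> //; apply: divsubM; [| apply: divsubN | apply: divsubM].
- under eq_bigr => p _ do rewrite -[p.1]conjr1.
  rewrite key ?unitr1 //; last by move=> x; rewrite conjr1.
  under eq_bigr => p _ do rewrite conjr1.
  by rewrite lk1 mulr1 conjr1 divrr // hD // subr_eq0 eq_sym.
move=> vus; rewrite key; last 2 first.
- by move=> x; apply: nK.
- exact: Uus.
move: vus; rewrite inE => /orP [/eqP ->|/lk0 ->]; first by rewrite subrr !mul0r.
by rewrite mulr0 mul0r.
Qed.

End Orbits.

(** * Abelian normal subgroups of a solvable normal closure *)

Section AbelianNormal.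
Variables (D : unitRingType) (hD : is_division_ring D).
Implicit Types (x y z g h : D) (S T G H J K X A : D -> Prop).

(** [H] normalizes the centralizer of [T], and this centralizer commutes with [J], hence with every
    [H]-conjugate of [J]. *)
Lemma cent_normal_closure H J T x : is_subgroup H ->
  (forall j, J j -> j \is a GRing.unit) -> (forall j, J j -> dgen T j) ->
  normalized_by H T -> cent T x -> cent (normal_closure H J) x.
Proof.
move=> sH UJ JT nT cx; have US z : (exists h j, [/\ H h, J j & z = conjr h j]) ->
    z \is a GRing.unit.
  by case=> h [j [Hh Jj ->]]; apply: unitr_conj; [apply: subgroup_unit Hh | apply: UJ].
suff cS : cent (fun z => exists h j, [/\ H h, J j & z = conjr h j]) x.
  by move=> y /(gen_dgen hD US); apply: cent_dgen.
move=> _ [h [j [Hh Jj ->]]]; have Uh := subgroup_unit sH Hh.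
rewrite -(conjrKV x Uh) -!conjrM //; congr conjr.
by apply: (cent_dgen hD _ (JT _ Jj)); exact: cent_normalized (subgroupV sH Hh) cx.
Qed.

Lemma conjr_eq_dgen (O : seq D) g h x : g \is a GRing.unit -> h \is a GRing.unit ->
  {in O, conjr g =1 conjr h} -> dgen (fun y => y \in O) x -> conjr g x = conjr h x.
Proof.
move=> Ug Uh e Kx; have Uhg : h^-1 * g \is a GRing.unit by rewrite unitrMl ?unitrV.
suff c : cent (fun y => y \in O) (h^-1 * g).
  have -> : conjr g x = conjr h (conjr (h^-1 * g) x).
    by rewrite conjr_comp ?unitrV // conjrKV.
  by congr conjr; apply/conjr_fixP => //; apply: (cent_dgen hD c).
by move=> y yO; apply/conjr_fixP => //; rewrite conjr_comp ?unitrV // e // conjrK.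
Qed.

Section FiniteAction.
Variables (X : D -> Prop) (O : seq D).
Hypotheses (sX : is_subgroup X) (nO : forall g x, X g -> x \in O -> conjr g x \in O).

Lemma agreeM g g' h h' : X g -> X g' -> X h -> X h' ->
  {in O, conjr g =1 conjr g'} -> {in O, conjr h =1 conjr h'} ->
  {in O, conjr (g * h) =1 conjr (g' * h')}.
Proof.
move=> Xg Xg' Xh Xh' eg eh x xO.
by rewrite !conjr_comp ?(subgroup_unit sX) // eh // eg // nO.
Qed.

Lemma agreeV g g' : X g -> X g' ->
  {in O, conjr g =1 conjr g'} -> {in O, conjr g^-1 =1 conjr g'^-1}.
Proof.
move=> Xg Xg' eg x xO; have Ug' := subgroup_unit sX Xg'; apply: (conjr_inj Ug').
have VO : conjr g^-1 x \in O by apply: nO => //; apply: subgroupV.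
by rewrite conjrKV // -eg // conjrKV //; apply: subgroup_unit Xg.
Qed.

(* With [C] the pointwise stabiliser of [O], the second hypothesis says [X = X' C], whence
   [X = X^(k) C] for all [k]. *)
Lemma solvable_agree_trivial : solvable_grp X ->
  (forall g, X g -> exists2 w, derived X w & {in O, conjr g =1 conjr w}) ->
  forall g, X g -> {in O, conjr g =1 id}.
Proof.
case=> n tX perf; suff key k g : X g ->
    exists2 w, derived_iter k X w & {in O, conjr g =1 conjr w}.
  move=> g /(key n) [w /tX -> e] x xO.
  by rewrite e // conjr1.
elim: k g => [|k IHk] g Xg; first by exists g.
have sXk m := derived_iter_subgroup m sX.
have leX m x : derived_iter m X x -> X x.
  by move=> Xmx; apply: (derived_iter_le (m := m) (n := 0) sX); rewrite addn0.
have [w Xw e] := perf g Xg.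
suff [_ [v Xv e']] : X w /\ exists2 v, derived_iter k.+1 X v & {in O, conjr w =1 conjr v}.
  by exists v => // x xO; rewrite e // e'.
apply: (gen_le (H := fun w => X w /\
  exists2 v, derived_iter k.+1 X v & {in O, conjr w =1 conjr v})) Xw.
- split=> [x [Xx _]||x y [Xx [x' Xx' ex]] [Xy [y' Xy' ey]]|x [Xx [x' Xx' ex]]].
  + exact: subgroup_unit Xx.
  + by split; [apply: subgroup1 | exists 1 => //; apply: subgroup1 (sXk _)].
  + split; first exact: subgroupM.
    exists (x' * y'); first exact: subgroupM (sXk _) Xx' Xy'.
    by apply: agreeM => //; [apply: leX _ _ Xx' | apply: leX _ _ Xy'].
  split; first exact: subgroupV.
  exists x'^-1; first exact: subgroupV (sXk _) Xx'.
  by apply: agreeV => //; apply: leX _ _ Xx'.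
move=> _ [x [y [Xx Xy ->]]]; split; first exact: subgroup_commutator.
have [x' Xx' ex] := IHk x Xx; have [y' Xy' ey] := IHk y Xy.
exists (commutator x' y'); first exact: derived_commutator.
have X'x := leX _ _ Xx'; have X'y := leX _ _ Xy'.
have [Vx Vy] := (subgroupV sX Xx, subgroupV sX Xy).
have [Vx' Vy'] := (subgroupV sX X'x, subgroupV sX X'y).
apply: agreeM => //; try by do 2?apply: subgroupM.
by apply: agreeM => //; try exact: subgroupM; apply: agreeM => //; apply: agreeV.
Qed.

End FiniteAction.

(** Suppose [g] in [X] agrees with no element of [X'] on the orbit [O] of [a]. A dual family then
    separates the identity from the other representatives [w] of [X'] and from all [g * w]. A trace
    over [X'] centralizes [X'], hence [X] because [J] lies in [F(X')], so [g] fixes it; pairing with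
    the dual family gives [1 = 0]. Hence [X] and [X'] act alike on [O], and solvability makes the
    action trivial. *)
Lemma abelian_normal_centralized H J A : is_subgroup H -> (forall j, J j -> H j) ->
  let X := normal_closure H J in
  solvable_grp X -> (forall j, J j -> dgen (derived X) j) ->
  abelian_set A -> normalized_by X A -> (forall a, A a -> algebraic_over_center a) ->
  forall x a, X x -> A a -> x * a = a * x.
Proof.
move=> sH JH X solX JX cA nA algA x a Xx Aa.
have UJ j : J j -> j \is a GRing.unit by move/JH; apply: subgroup_unit.
have sX : is_subgroup X by apply: normal_closure_subgroup.
have nX : normalized_by H X by apply: normal_closure_normalized.
have sX' := derived_subgroup sX.
have centX t : cent (derived X) t -> cent X t.
  by move=> ct; apply: (cent_normal_closure sH UJ JX) ct; apply: derived_normalized.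
clearbody X.
have [O [UO OP]] : exists O : seq D,
    uniq O /\ forall x, x \in O <-> exists2 g, X g & x = conjr g a.
  by apply: finite_orbit => // [|g h Xg Xh]; [apply: algA | apply: cA; apply: nA].
have nO g y : X g -> y \in O -> conjr g y \in O.
  move=> Xg /OP [h Xh ->]; apply/OP; exists (g * h); first exact: subgroupM.
  by rewrite conjr_comp //; apply: subgroup_unit sX _.
have aO : a \in O by apply/OP; exists 1; [apply: subgroup1 | rewrite conjr1].
apply/conjr_fixP; first exact: subgroup_unit Xx.
apply: (solvable_agree_trivial sX nO solX _ Xx) => // g Xg.
apply: contrapT => ng.
have nO' h y : derived X h -> y \in O -> conjr h y \in O.
  by move=> /(derived_le sX); apply: nO.
have [ws [wsX' sum_ws]] := coset_representatives sX' UO nO'.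
have wsX w : w \in ws -> X w by move/wsX'; apply: derived_le.
pose K := dgen (fun y => y \in O).
have dK : division_subring K by apply: dgen_division_subring.
have cK : abelian_set K.
  by apply: dgen_abelian => // y z /OP [h Xh ->] /OP [k Xk ->]; apply: cA; apply: nA.
have nK h y : X h -> K y -> K (conjr h y).
  by apply: (dgen_normalized hD sX) => u v Xu; apply: nO.
pose us := [seq w <- ws | ~~ `[< {in O, conjr w =1 id} >]] ++ [seq g * w | w <- ws].
have usX u : u \in us -> X u.
  rewrite mem_cat mem_filter => /orP [/andP [_ /wsX] //|/mapP [w /wsX Xw ->]].
  exact: subgroupM.
have [lk [Klk lk1 lk0]] : exists lk : seq (D * D),
    [/\ forall p, p \in lk -> K p.1 /\ K p.2,
        \sum_(p <- lk) p.1 * p.2 = 1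
      & forall u, u \in us -> \sum_(p <- lk) conjr u p.1 * p.2 = 0].
  apply: dual_family => // [u y /usX|u /usX|u]; [exact: nK | exact: subgroup_unit |].
  move=> uus; suff : ~ {in O, conjr u =1 id}.
    move=> nu; apply: contrapT => nl; apply: nu => y yO; apply: contrapT => /eqP ny.
    by apply: nl; exists y => //; apply: dgen_sub.
  move: uus; rewrite mem_cat => /orP [|/mapP [w wws ->] e].
    by rewrite mem_filter => /andP [/asboolPn].
  apply: ng; exists w^-1; first by apply: (subgroupV sX'); apply: wsX'.
  move=> y yO; have Uw := subgroup_unit sX (wsX _ wws); have Ug := subgroup_unit sX Xg.
  have VO : conjr w^-1 y \in O by apply: nO => //; apply: subgroupV => //; apply: wsX.
  by rewrite -{1}(conjrKV y Uw) -conjr_comp // e.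
have trace_fixed l : K l -> \sum_(w <- ws) conjr (g * w) l = \sum_(w <- ws) conjr w l.
  move=> Kl; pose t := \sum_(w <- ws) conjr w l.
  have [sum_t _] := sum_ws (fun w => conjr w l) (fun u v Xu Xv e =>
    conjr_eq_dgen (subgroup_unit sX' Xu) (subgroup_unit sX' Xv) e Kl).
  have Ug := subgroup_unit sX Xg.
  have ct : cent (derived X) t.
    move=> v X'v; apply/esym/conjr_fixP; first exact: subgroup_unit X'v.
    rewrite /t conjr_sum -[RHS](sum_t _ X'v) big_seq [RHS]big_seq.
    apply: eq_bigr => w /wsX' X'w; rewrite conjr_comp //; exact: subgroup_unit sX' _.
  have gt : conjr g t = t.
    apply/conjr_fixP => //; apply/esym; apply: centX ct _ Xg.
  rewrite -/t -gt /t conjr_sum big_seq [RHS]big_seq.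
  by apply: eq_bigr => w /wsX Xw; rewrite conjr_comp //; apply: subgroup_unit Xw.
(* Only the representative acting trivially on [O] contributes. *)
have sum1 : \sum_(w <- ws) \sum_(p <- lk) conjr w p.1 * p.2 = 1.
  have [|_ ->] := sum_ws (fun w => \sum_(p <- lk) conjr w p.1 * p.2).
  - move=> u v Xu Xv e; rewrite big_seq [RHS]big_seq; apply: eq_bigr => p /Klk [Kp _].
    by congr (_ * _); apply: conjr_eq_dgen e Kp; apply: subgroup_unit sX' _.
  - by rewrite -[RHS]lk1; apply: eq_bigr => p _; rewrite conjr1.
  move=> w wws nw; apply: lk0; rewrite mem_cat mem_filter wws andbT.
  by apply/orP; left; apply/asboolPn.
(* Replacing each [w] by [g * w] does not change the traces, yet the dual family kills every
   resulting term. *)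
have := oner_neq0 D; rewrite -{1}sum1 exchange_big /=.
under eq_big_seq => p plk.
  rewrite -mulr_suml -trace_fixed ?mulr_suml; last by case: (Klk p plk).
  over.
rewrite exchange_big /= big_seq big1 ?eqxx // => w wws; apply: lk0.
by rewrite mem_cat; apply/orP; right; apply: map_f.
Qed.

End AbelianNormal.
(** * Torsion in groups of class two *)

Definition torsion (D : unitRingType) (Y : D -> Prop) (t : D) : Prop :=
  Y t /\ exists2 n, (0 < n)%N & t ^+ n = 1.

(** When [s] and [t] are anticommuting square roots of -1, these are the six elements of order four
    in the quaternion group they generate. *)
Definition quaternion_units (D : unitRingType) (s t : D) : seq D :=
  [:: s; - s; t; - t; s * t; - (s * t)].

Section NilpotentClassTwo.
Variables (D : unitRingType) (hD : is_division_ring D).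
Implicit Types (x y z g h c s t u v : D) (G Y : D -> Prop).

Lemma sqr_eq1 x : x ^+ 2 = 1 -> x = 1 \/ x = -1.
Proof.
move=> x2; have /(mulr_eq0P hD) [/eqP|/eqP] : (x - 1) * (x + 1) = 0.
  by rewrite mulrBl mul1r mulrDr mulr1 -expr2 x2 [1 + x]addrC subrr.
  by rewrite subr_eq0 => /eqP; left.
by rewrite addr_eq0 => /eqP; right.
Qed.

Lemma comm_sqr_eq x y : x * y = y * x -> x ^+ 2 = y ^+ 2 -> x = y \/ x = - y.
Proof.
move=> cxy e; have /(mulr_eq0P hD) [/eqP|/eqP] : (x - y) * (x + y) = 0.
  by rewrite mulrBl !mulrDr -!expr2 e cxy [y * x + _]addrC subrr.
  by rewrite subr_eq0 => /eqP; left.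
by rewrite addr_eq0 => /eqP; right.
Qed.

Lemma exprMl_comm x y c n : x * y = y * x * c -> c * x = x * c -> c * y = y * c ->
  x ^+ n * y = y * x ^+ n * c ^+ n.
Proof.
move=> xy cx cy; elim: n => [|n IHn]; first by rewrite !expr0 mul1r !mulr1.
rewrite !exprS -mulrA IHn !mulrA xy -!mulrA; congr (_ * (_ * _)).
by rewrite !mulrA (commrX n (cx : GRing.comm c x)).
Qed.

Lemma exprMr_comm x y c n : x * y = y * x * c -> c * x = x * c -> c * y = y * c ->
  x * y ^+ n = y ^+ n * x * c ^+ n.
Proof.
move=> xy cx cy; elim: n => [|n IHn]; first by rewrite !expr0 mul1r !mulr1.
rewrite [y ^+ n.+1]exprS mulrA xy -!mulrA (commrX n (cy : GRing.comm c y)).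
by rewrite [x * _]mulrA IHn exprSr !mulrA.
Qed.

(** Moving [x ^+ k] past the next [y] costs [c ^+ k]; the exponents [0, ..., n - 1] add up to the
    binomial coefficient. *)
Lemma exprMn_class2 x y c n : x * y = y * x * c -> c * x = x * c -> c * y = y * c ->
  (y * x) ^+ n = y ^+ n * x ^+ n * c ^+ 'C(n, 2).
Proof.
move=> xy cx cy; elim: n => [|n IHn]; first by rewrite !expr0 !mulr1.
have cyx m : GRing.comm (c ^+ m) (y * x).
  by apply/commr_sym/commrX; rewrite /GRing.comm mulrA cy -!mulrA cx.
rewrite exprSr IHn -mulrA cyx !mulrA -[y ^+ n * x ^+ n * y]mulrA.
have cnx : c ^+ n * x = x * c ^+ n by apply/commr_sym/commrX.
rewrite (exprMl_comm n xy cx cy) binS bin1 addnC exprD [y ^+ n.+1]exprSr [x ^+ n.+1]exprSr.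
by rewrite !mulrA -[_ * c ^+ n * x]mulrA cnx !mulrA.
Qed.

Lemma expr_coprime_eq1 x m n : coprime m n -> (0 < m)%N -> x ^+ m = 1 -> x ^+ n = 1 -> x = 1.
Proof.
move=> cmn m0 xm xn; case: (egcdnP n m0) => a b e _.
have := congr1 (fun k => x ^+ k) e; rewrite /= mulnC exprM xm expr1n.
by rewrite (eqP cmn) exprD mulnC exprM xn expr1n mul1r expr1.
Qed.

(** Conjugating [x] by powers of [y] gives the commuting roots [x * c ^+ i] of the polynomial of
    [x], so two of the first [size p] coincide. The factorial makes the exponent independent of
    [y]. *)
Lemma algebraic_commutator_torsion x : algebraic_over_center x -> x != 0 ->
  exists2 n, (0 < n)%N & forall y c, y != 0 -> x * y = y * x * c ->
    c * x = x * c -> c * y = y * c -> c ^+ n = 1.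
Proof.
move=> [p [p0 cp px]] /hD Ux; exists (size p)`!; first exact: fact_gt0.
move=> y c /hD Uy xy cx cy; pose rs := [seq x * c ^+ i | i <- iota 0 (size p)].
have Uc : c \is a GRing.unit.
  have -> : c = (y * x)^-1 * (x * y) by rewrite xy mulKr // unitrMl.
  by rewrite unitrMl ?unitrV unitrMl.
have : ~~ uniq rs.
  apply/negP => Urs; have : (size rs < size p)%N.
    apply: commuting_roots_bound => // [_ /mapP [i _ ->]|_ _ /mapP [i _ ->] /mapP [j _ ->]].
      have -> : x * c ^+ i = conjr (y ^+ i)^-1 x.
        by rewrite /conjr invrK -mulrA (exprMr_comm i xy cx cy) -!mulrA mulKr // unitrX.
      by apply: conjr_root => //; rewrite unitrV unitrX.
    have cxi k : GRing.comm x (c ^+ k) by apply: commrX.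
    rewrite -!mulrA (mulrA (c ^+ i)) -(cxi i) (mulrA (c ^+ j)) -(cxi j) -!mulrA.
    by rewrite -!exprD addnC.
  by rewrite size_map size_iota ltnn.
case/(uniqPn 0) => i [j [ltij]]; rewrite size_map size_iota => ltjp.
have ltip := ltn_trans ltij ltjp.
rewrite !(nth_map 0%N) ?size_iota // !nth_iota // !add0n => /(mulrI Ux) e.
have cji : c ^+ (j - i) = 1.
  by apply: (mulrI (unitrX i Uc)); rewrite -exprD subnKC ?mulr1 ?(ltnW ltij).
have /dvdnP [q ->] : (j - i %| (size p)`!)%N.
  by apply: dvdn_fact; rewrite subn_gt0 ltij (leq_trans (leq_subr _ _)) // ltnW.
by rewrite mulnC exprM cji expr1n.
Qed.

(** Otherwise [v] and the [n] distinct powers of [u] would be [n + 1] commuting roots of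
    [X^n - 1]. *)
Lemma root_of_unity_power u v n : (0 < n)%N -> u ^+ n = 1 -> v ^+ n = 1 -> u * v = v * u ->
  (forall j, (0 < j < n)%N -> u ^+ j != 1) -> exists k, v = u ^+ k.
Proof.
move=> n0 un vn cuv prim; pose rs := [seq u ^+ i | i <- iota 0 n].
case: (boolP (v \in rs)) => [/mapP [k _ ->]|vrs]; first by exists k.
have Uu : u \is a GRing.unit 
  by rewrite -(unitrX_pos u n0) un unitr1.
have ne i j : (i < j < n)%N -> u ^+ i != u ^+ j.
  move=> /andP [ltij ltjn]; apply/eqP => e.
  have := prim (j - i)%N; rewrite subn_gt0 ltij (leq_ltn_trans (leq_subr _ _)) //.
  move/(_ isT)/eqP; apply; apply: (mulrI (unitrX i Uu)).
  by rewrite -exprD subnKC ?mulr1 ?(ltnW ltij).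
have Urs : uniq rs.
  apply: contraT => /(uniqPn 0) [i [j [ltij]]]; rewrite size_map size_iota => ltjn.
  have ltin := ltn_trans ltij ltjn.
  rewrite !(nth_map 0%N) ?size_iota // !nth_iota // !add0n => /eqP.
  by rewrite (negPf (ne i j _)) // ltij.
have : (size (v :: rs) < size ('X^n - 1%:P : {poly D})%R)%N.
  apply: commuting_roots_bound => //.
  - by rewrite -size_poly_eq0 size_XnsubC.
  - by rewrite /= vrs.
  - move=> x; rewrite !hornerE hornerXn inE => /orP [/eqP ->|/mapP [i _ ->]].
      by rewrite vn subrr.
    by rewrite -exprM mulnC exprM un expr1n subrr.
  have cv k : v * u ^+ k = u ^+ k * v by apply: commrX.
  move=> x y; rewrite !inE => /orP [/eqP ->|/mapP [i _ ->]] /orP [/eqP ->|/mapP [j _ ->]] //.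
  by rewrite -!exprD addnC.
by rewrite size_XnsubC //= size_map size_iota ltnn.
Qed.

Section ClassTwo.
Variable Y : D -> Prop.
Hypotheses (sY : is_subgroup Y) (cY : forall z, derived Y z -> cent Y z).

Lemma class2_commutator x y : Y x -> Y y ->
  exists c, [/\ x * y = y * x * c, Y c & cent Y c].
Proof.
move=> Yx Yy; have [Ux Uy] := (subgroup_unit sY Yx, subgroup_unit sY Yy).
exists (commutator x y); split; last by apply: cY; apply: derived_commutator.
  by rewrite /commutator -!mulrA !mulVKr.
exact: subgroup_commutator.
Qed.

(** If [x ^+ m = 1], the commutator [c] of [x] and [y] satisfies [c ^+ m = 1]; by the class-two
    formula [(x * y) ^+ (m * n)] is a power of [c]. *)
Lemma torsion_subgroup : is_subgroup (torsion Y).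
Proof.
split=> [x [Yx _]||x y [Yx [m m0 xm]] [Yy [n n0 yn]]|x [Yx [m m0 xm]]].
- exact: subgroup_unit Yx.
- by split; [apply: subgroup1 | exists 1%N].
- split; first exact: subgroupM.
  have [c [yx _ cc]] := class2_commutator Yy Yx.
  have cm : c ^+ m = 1.
    have := exprMr_comm m yx (cc _ Yy) (cc _ Yx); rewrite xm mulr1 mul1r => e.
    by apply: (mulrI (subgroup_unit sY Yy)); rewrite -e mulr1.
  exists (m * n * m)%N; first by rewrite !muln_gt0 m0 n0.
  rewrite exprM (exprMn_class2 _ yx (cc _ Yy) (cc _ Yx)).
  rewrite exprM xm expr1n [(m * n)%N]mulnC exprM yn expr1n !mul1r.
  by rewrite -exprM mulnC exprM cm expr1n.
by split; [apply: subgroupV | exists m; rewrite // exprVn xm invr1].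
Qed.

Lemma torsion_normalized G : is_subgroup G -> normalized_by G Y ->
  normalized_by G (torsion Y).
Proof.
move=> sG nY g x Gg [Yx [m m0 xm]]; have Ug := subgroup_unit sG Gg.
by split; [apply: nY | exists m; rewrite // -conjrX // xm conjr_id].
Qed.

Lemma class2_power_central y : Y y -> algebraic_over_center y ->
  exists2 n, (0 < n)%N & cent Y (y ^+ n).
Proof.
move=> Yy algy; have y0 := unitr_neq0 (subgroup_unit sY Yy).
have [n n0 cn] := algebraic_commutator_torsion algy y0; exists n => // x Yx.
have [c [yx _ cc]] := class2_commutator Yy Yx.
rewrite (exprMl_comm n yx (cc _ Yy) (cc _ Yx)) (cn x c) ?mulr1 ?cc //.
by apply: unitr_neq0; apply: subgroup_unit Yx.
Qed.

(** Some [y ^+ n] is central in [Y], hence fixed by [G]. In the [n]-th power of [g y g^-1 y^-1] the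
    factors [y ^+ n] and [y ^- n] cancel, leaving a power of a commutator killed by [n]. *)
Lemma displacement_torsion G g y : is_subgroup G -> normalized_by G Y ->
  (forall z, Y z -> cent Y z -> cent G z) -> algebraic_over_center y ->
  G g -> Y y -> torsion Y (conjr g y * y^-1).
Proof.
move=> sG nY cZ algy Gg Yy; have Ug := subgroup_unit sG Gg.
have Uy := subgroup_unit sY Yy; have YVy := subgroupV sY Yy.
have Yw : Y (conjr g y) by apply: nY.
have [n n0 cn] := class2_power_central Yy algy.
split; first exact: subgroupM.
have [c [vw _ cc]] := class2_commutator YVy Yw.
have ccn : c ^+ n = 1.
  have e := exprMl_comm n vw (cc _ YVy) (cc _ Yw).
  have Uvn : (y^-1) ^+ n \is a GRing.unit by rewrite unitrX // unitrV.
  apply: (mulrI (_ : conjr g y * y^-1 ^+ n \is a GRing.unit)).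
    by rewrite unitrMl // unitr_conj.
  rewrite -e mulr1 exprVn; apply: (mulrI (unitrX n Uy)); rewrite mulVKr ?unitrX //.
  by rewrite mulrA cn // mulrK // unitrX.
exists (n * n)%N; first by rewrite muln_gt0 n0.
rewrite exprM (exprMn_class2 _ vw (cc _ YVy) (cc _ Yw)) -conjrX //.
have -> : conjr g (y ^+ n) = y ^+ n.
  by apply/conjr_fixP => //; apply/esym/cZ => //; apply: subgroupX.
by rewrite exprVn divrr ?unitrX // mul1r -exprM mulnC exprM ccn expr1n.
Qed.

Lemma quaternion_dichotomy u s : Y u -> Y s -> u ^+ 2 = -1 -> s ^+ 2 = -1 ->
  u * s = s * u \/ u * s = - (s * u).
Proof.
move=> Yu Ys u2 s2; have [c [us _ cc]] := class2_commutator Yu Ys.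
have e := exprMl_comm 2 us (cc _ Yu) (cc _ Ys).
have Us := subgroup_unit sY Ys.
have : c ^+ 2 = 1.
  apply: (mulrI (_ : s * u ^+ 2 \is a GRing.unit)); first by rewrite u2 mulrN1 unitrN.
  by rewrite -e mulr1 u2 mulN1r mulrN1.
by case/sqr_eq1 => c1; [left | right]; rewrite us c1 ?mulr1 // mulrN1.
Qed.

(** If [u] commutes with neither [s] nor [t], it anticommutes with both and so commutes with
    [s * t]. Commuting elements with equal squares agree up to sign. *)
Lemma quaternion_units_complete s t u : Y s -> Y t -> Y u ->
  s ^+ 2 = -1 -> t ^+ 2 = -1 -> s * t = - (t * s) -> u ^+ 2 = -1 ->
  u \in quaternion_units s t.
Proof.
move=> Ys Yt Yu s2 t2 st u2; rewrite !inE.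
case: (quaternion_dichotomy Yu Ys u2 s2) => us.
  by have [|->|->] := comm_sqr_eq us; rewrite ?eqxx ?orbT // u2 s2.
case: (quaternion_dichotomy Yu Yt u2 t2) => ut.
  by have [|->|->] := comm_sqr_eq ut; rewrite ?eqxx ?orbT // u2 t2.
have cust : u * (s * t) = s * t * u by rewrite mulrA us mulNr -[s * u * t]mulrA ut mulrN opprK mulrA.
have st2 : (s * t) ^+ 2 = -1.
  rewrite expr2 mulrA -(mulrA s) [t * s](_ : _ = - (s * t)); last by rewrite st opprK.
  by rewrite mulrN mulNr !mulrA -expr2 s2 -mulrA -expr2 t2 mulrN1 opprK.
by have [|->|->] := comm_sqr_eq cust; rewrite ?eqxx ?orbT // u2 st2.
Qed.

End ClassTwo.
End NilpotentClassTwo.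

(** * Quaternion pairs in nonabelian torsion of class two *)

Section TorsionQuaternion.
Variables (D : unitRingType) (hD : is_division_ring D) (Y : D -> Prop).
Hypotheses (sY : is_subgroup Y) (cY : forall z, derived Y z -> cent Y z).
Implicit Types (s t c : D) (m n p : nat).

Lemma minimal_torsion_pair : ~ abelian_set (torsion Y) ->
  exists s t m n, [/\ Y s, Y t, s * t != t * s, (0 < m <= n)%N & s ^+ m = 1 /\ t ^+ n = 1] /\
    forall s' t' m' n', Y s' -> Y t' -> s' ^+ m' = 1 -> t' ^+ n' = 1 ->
      (0 < m')%N -> (0 < n')%N -> (m' + n' < m + n)%N -> s' * t' = t' * s'.
Proof.
move=> nab; pose Q k := exists s t m n,
  [/\ [/\ Y s, Y t & s * t != t * s], (0 < m)%N, (0 < n)%N, s ^+ m = 1 /\ t ^+ n = 1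
    & (m + n)%N = k].
have [k Qk] : exists k, `[< Q k >].
  apply: contrapT => nQ; apply: nab => s t [Ys [m m0 sm]] [Yt [n n0 tn]].
  apply/eqP; apply: contra_notT nQ => st; exists (m + n)%N; apply/asboolP.
  by exists s, t, m, n; split.
have exQ : exists k, `[< Q k >] by exists k.
case: (ex_minnP exQ) => {k Qk} k /asboolP [s [t [m [n [[Ys Yt st] m0 n0 [sm tn] e]]]]] mink.
have min' s' t' m' n' : Y s' -> Y t' -> s' ^+ m' = 1 -> t' ^+ n' = 1 ->
    (0 < m')%N -> (0 < n')%N -> (m' + n' < m + n)%N -> s' * t' = t' * s'.
  move=> Ys' Yt' sm' tn' m0' n0'; rewrite e => lt; apply: contrapT => /eqP st'.
  by move: lt; rewrite ltnNge mink //; apply/asboolP; exists s', t', m', n'.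
case: (leqP m n) => mn; first by exists s, t, m, n; split=> //; rewrite m0 mn.
exists t, s, n, m; split; first by split=> //; [rewrite eq_sym | rewrite n0 ltnW].
by move=> s' t' m' n'; rewrite (addnC n); apply: min'.
Qed.

(** A noncommuting pair with minimal exponents lives at a single prime [p]. Correcting [s] by a
    power of [t] forces [p = 2], and the corrected pair is the quaternion pair. *)
Lemma torsion_quaternion : ~ abelian_set (torsion Y) ->
  exists s t, [/\ Y s, Y t, s ^+ 2 = -1 /\ t ^+ 2 = -1, s * t = - (t * s) & s * t != t * s].
Proof.
move=> /minimal_torsion_pair [s [t [m [n [[Ys Yt nst /andP [m0 mn] [sm tn]] mini]]]]].
have n0 := leq_trans m0 mn.
have [Us Ut] := (subgroup_unit sY Ys, subgroup_unit sY Yt).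
have YX := fun x k => @subgroupX D Y x k sY.
have [c [stc _ cc]] := class2_commutator sY cY Ys Yt.
have [cs ct] := (cc _ Ys, cc _ Yt).
have c1 : c != 1 by apply: contraNneq nst => e; rewrite stc e mulr1.
have Uts : t * s \is a GRing.unit by rewrite unitrMl.
have tprim j : (0 < j < n)%N -> t ^+ j != 1.
  move=> /andP [j0 jn]; apply: contraNneq nst => tj; apply/eqP.
  by apply: (mini s t m j); rewrite ?ltn_add2l.
(* Passing from [s] to [s ^+ p] lowers the exponent, so minimality makes [s ^+ p] commute with
   [t]. *)
have redm p : prime p -> (p %| m)%N -> s ^+ p * t = t * s ^+ p /\ c ^+ p = 1.
  move=> pr_p /dvdnP [q mq]; have q0 : (0 < q)%N by case: q mq m0 => // ->.
  have e : s ^+ p * t = t * s ^+ p.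
    apply: (mini _ _ q n) => //; first exact: YX.
      by rewrite -exprM mulnC -mq.
    by rewrite ltn_add2r mq -[X in (X < _)%N]muln1 ltn_mul2l q0 prime_gt1.
  split=> //; have := exprMl_comm p stc cs ct; rewrite e => e'.
  apply: (mulrI (_ : t * s ^+ p \is a GRing.unit)); first by rewrite unitrMl // unitrX.
  by rewrite -e' mulr1.
have redn q : prime q -> (q %| n)%N -> s * t ^+ q = t ^+ q * s /\ c ^+ q = 1.
  move=> pr_q /dvdnP [r nr]; have r0 : (0 < r)%N by case: r nr n0 => // ->.
  have e : s * t ^+ q = t ^+ q * s.
    apply: (mini _ _ m r) => //; first exact: YX.
      by rewrite -exprM mulnC -nr.
    by rewrite ltn_add2l nr -[X in (X < _)%N]muln1 ltn_mul2l r0 prime_gt1.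
  split=> //; have := exprMr_comm q stc cs ct; rewrite e => e'.
  apply: (mulrI (_ : t ^+ q * s \is a GRing.unit)); first by rewrite unitrMl // unitrX.
  by rewrite -e' mulr1.
have m1 : (1 < m)%N.
  rewrite ltn_neqAle m0 andbT; apply: contraNneq nst => m1.
  by move: sm; rewrite -m1 expr1 => ->; rewrite mul1r mulr1.
pose p := pdiv m; have pr_p : prime p by apply: pdiv_prime.
have [cst cp] := redm p pr_p (pdiv_dvd m).
have uniq_p q : prime q -> c ^+ q = 1 -> q = p.
  move=> pr_q cq; apply/eqP; apply: contraNT c1 => qp; apply/eqP.
  apply: (expr_coprime_eq1 (m := q) (n := p)) => //; last exact: prime_gt0.
  by rewrite prime_coprime // dvdn_prime2.
have [a ma] : {a | m = p ^ a}%N.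
  by apply/p_natP/pnatP => // q pr_q qm; rewrite (uniq_p q) ?inE //; case: (redm q).
have [b nb] : {b | n = p ^ b}%N.
  by apply/p_natP/pnatP => // q pr_q qn; rewrite (uniq_p q) ?inE //; case: (redn q).
have p1 := prime_gt1 pr_p; have p0 := prime_gt0 pr_p.
have leab : (a <= b)%N by rewrite -(leq_exp2l _ _ p1) -ma -nb.
have sn : s ^+ n = 1.
  have /dvdnP [q ->] : (m %| n)%N by rewrite ma nb dvdn_exp2l.
  by rewrite mulnC exprM sm expr1n.
have pn : (p %| n)%N.
  by rewrite nb dvdn_exp // lt0n; apply: contraTneq m1 => b0; rewrite ma; move: leab;
    rewrite b0 leqn0 => /eqP ->.
have [k spk] : exists k, s ^+ p = (t ^+ p) ^+ k.
  apply: (root_of_unity_power hD (n := n %/ p)).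
  - by rewrite divn_gt0 // dvdn_leq.
  - by rewrite -exprM mulnC divnK.
  - by rewrite -exprM mulnC divnK.
  - by apply/esym/commrX.
  move=> j /andP [j0 jn]; rewrite -exprM; apply: tprim.
  by rewrite muln_gt0 p0 j0 mulnC -ltn_divRL.
(* The factor [t ^- k] cancels [s ^+ p], so that [s1 ^+ p] reduces to the commutator term
   [d ^+ 'C(p, 2)]. *)
pose r := (t ^- k); pose s1 := s * r.
have Yr : Y r by apply: subgroupV => //; apply: YX.
have Ys1 : Y s1 by apply: subgroupM.
have rt : r * t = t * r by rewrite /r -exprVn; apply/esym/commrX/commrV.
have s1t : s1 * t = t * s1 * c by rewrite /s1 -mulrA rt mulrA stc -!mulrA (cc _ Yr).
have ns1t : s1 * t != t * s1.
  rewrite s1t; apply: contraNneq c1 => e; apply/eqP.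
  apply: (mulrI (_ : t * s1 \is a GRing.unit)); last by rewrite e mulr1.
  by rewrite unitrMl //; apply: subgroup_unit Ys1.
have [d [rs _ cd]] := class2_commutator sY cY Yr Ys.
have s1p : s1 ^+ p = d ^+ 'C(p, 2).
  rewrite (exprMn_class2 _ rs (cd _ Yr) (cd _ Ys)) spk.
  by rewrite /r exprVn -!exprM [(k * p)%N]mulnC divrr ?mul1r // unitrX.
have dp : d ^+ p = 1.
  have e := exprMr_comm p rs (cd _ Yr) (cd _ Ys).
  apply: (mulrI (_ : s ^+ p * r \is a GRing.unit)).
    by rewrite unitrMl ?unitrX //; apply: subgroup_unit Yr.
  rewrite -e mulr1 /r; apply/esym/commrV/commrX; exact: cst.
(* Otherwise [s1] would be a power of the primitive [p]-th root of unity [c], and would commute with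
   [t]. *)
have ncs1 : s1 ^+ p <> 1.
  move=> s1p1; have [] := root_of_unity_power hD p0 cp s1p1 (cc _ Ys1).
    move=> j /andP [j0 jp]; apply: contra_neq c1 => cj.
    apply: (expr_coprime_eq1 (m := j) (n := p)) => //.
    by rewrite coprime_sym prime_coprime // gtnNdvd.
  move=> l s1l; case/eqP: ns1t; rewrite s1l.
  by apply/esym; apply: commrX; apply/esym.
have p2 : p = 2%N.
  apply/eqP; apply: contra_notT ncs1 => np2; rewrite s1p.
  (* For odd [p] the binomial coefficient is a multiple of [p], while [d ^+ p = 1]. *)
  have /dvdnP [q ->] : (p %| 'C(p, 2))%N by rewrite prime_dvd_bin //= ltn_neqAle eq_sym np2.
  by rewrite mulnC exprM dp expr1n.
move: cp dp s1p ncs1 pn; rewrite p2 => cp dp; rewrite binn expr1 => s1d nd pn.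
have cN1 : c = -1 by case: (sqr_eq1 hD cp) => // e; rewrite e eqxx in c1.
have s1N : s1 ^+ 2 = -1 by case: (sqr_eq1 hD dp) => e; rewrite s1d // in nd *.
have s1tN : s1 * t = - (t * s1) by rewrite s1t cN1 mulrN1.
have b2 : (1 < b)%N.
  case: b nb leab => [|[|//]] nb _; first by rewrite nb p2 in pn.
  have t2 : t ^+ 2 = 1 by move: tn; rewrite nb p2 expn1.
  by case/eqP: nst; case: (sqr_eq1 hD t2) => ->; rewrite ?mulr1 ?mul1r // mulrN1 mulN1r.
(* With [n = 4 q] the order of [t], the power [t ^+ q] is a square root of -1; the goal is
   [q = 1]. *)
pose q := (2 ^ (b - 2))%N.
have nq : n = (q * 4)%N by rewrite nb p2 -[4%N]/(2 ^ 2)%N -expnD subnK.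
have q0 : (0 < q)%N by rewrite expn_gt0.
have iN : (t ^+ q) ^+ 2 = -1.
  have : ((t ^+ q) ^+ 2) ^+ 2 = 1 by rewrite -tn nq -!exprM.
  case/(sqr_eq1 hD) => // /eqP; rewrite -exprM (negPf (tprim _ _)) // nq.
  by rewrite muln_gt0 q0 ltn_mul2l q0.
case: (posnP (b - 2)) => [b0|b0].
  exists s1, t; split=> //; split=> //; move: iN; by rewrite /q b0 expr1.
(* Here [q] is even, so [s1] commutes with [t ^+ q]. Equal squares make them agree up to sign, and
   [s1] would commute with [t]. *)
have cs1t2 : s1 * t ^+ 2 = t ^+ 2 * s1.
  by rewrite expr2 mulrA s1tN mulNr -[t * s1 * t]mulrA s1tN mulrN opprK mulrA.
have ciq : s1 * t ^+ q = t ^+ q * s1.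
  by rewrite /q -(prednK b0) expnS exprM; apply: commrX.
case/eqP: ns1t; have [|->|->] := comm_sqr_eq hD ciq; first by rewrite s1N iN.
  by apply/esym/commrX.
by rewrite mulNr mulrN; congr (- _); apply/esym/commrX.
Qed.

End TorsionQuaternion.
(** * Groups permuting a quaternion basis *)

Section QuaternionAction.
Variables (D : unitRingType) (X : D -> Prop) (s t : D).
Hypotheses (sX : is_subgroup X) (Us : s \is a GRing.unit) (Ut : t \is a GRing.unit).
Hypothesis nst : s * t != t * s.
Hypothesis nX : forall g u, X g -> u \in quaternion_units s t ->
  conjr g u \in quaternion_units s t.

Let axis (i : 'I_3) : D := [:: s; t; s * t]`_i.
Let same_axis (x y : D) : Prop := x = y \/ x = - y.
Let moves g (sigma : {perm 'I_3}) : Prop :=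
  forall i, same_axis (conjr g (axis i)) (axis (sigma i)).

Let same_axis_trans x y z : same_axis x y -> same_axis y z -> same_axis x z.
Proof. by case=> -> [] ->; rewrite ?opprK; [left | right | right | left]. Qed.

Let same_axis_conj g x y : same_axis x y -> same_axis (conjr g x) (conjr g y).
Proof. by case=> ->; rewrite ?conjrN; [left | right]. Qed.

(** Elements on one axis commute, whereas [s], [t] and [s * t] are pairwise noncommuting. *)
Let axis_inj i j : same_axis (axis i) (axis j) -> i = j.
Proof.
move=> ij; have {ij} : axis i * axis j = axis j * axis i.
  by case: ij => ->; rewrite ?mulrN ?mulNr.
have sst : s * (s * t) <> s * t * s.
  by rewrite -mulrA => /(mulrI Us) e; case/eqP: (nst).
have tst : t * (s * t) <> s * t * t.
  by rewrite mulrA => /(mulIr Ut) e; case/eqP: (nst).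
have /eqP nst' := nst.
by case: i j => [[|[|[|//]]] li] [[|[|[|//]]] lj] //= e; apply/val_inj => //=;
  first [by case: nst'; apply: esym | by case: sst; apply: esym | by case: tst; apply: esym].
Qed.

Let moves_exist g : X g -> exists sigma, moves g sigma.
Proof.
move=> Xg; have Ug := subgroup_unit sX Xg.
have /choice [f fP] i : exists j, same_axis (conjr g (axis i)) (axis j).
  have Qi : axis i \in quaternion_units s t.
    by case: i => [[|[|[|//]]] li]; rewrite !inE eqxx ?orbT.
  move: (nX Xg Qi); rewrite !inE.
  case/orP=> [/eqP ->|]; first by exists (@Ordinal 3 0 isT); left.
  case/orP=> [/eqP ->|]; first by exists (@Ordinal 3 0 isT); right.
  case/orP=> [/eqP ->|]; first by exists (@Ordinal 3 1 isT); left.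
  case/orP=> [/eqP ->|]; first by exists (@Ordinal 3 1 isT); right.
  case/orP=> [/eqP ->|/eqP ->]; first by exists (@Ordinal 3 2 isT); left.
  by exists (@Ordinal 3 2 isT); right.
have inj_f : injective f.
  move=> i j e; apply: axis_inj; rewrite -(conjrK (axis i) Ug) -(conjrK (axis j) Ug).
  apply: same_axis_conj; apply: same_axis_trans (fP i) _; rewrite e.
  by case: (fP j) => ->; rewrite ?opprK; [left | right; rewrite opprK].
by exists (perm inj_f) => i; rewrite permE; apply: fP.
Qed.

Let moves1 : moves 1 1%g.
Proof. by move=> i; rewrite conjr1 perm1; left. Qed.

Let movesM g h sigma tau : X g -> X h -> moves g sigma -> moves h tau ->
  moves (g * h) (tau * sigma)%g.
Proof.
move=> Xg Xh mg mh i; rewrite conjr_comp ?(subgroup_unit sX) // permM.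
exact: same_axis_trans (same_axis_conj g (mh i)) (mg _).
Qed.

Let movesV g sigma : X g -> moves g sigma -> moves g^-1 sigma^-1%g.
Proof.
move=> Xg mg i; have Ug := subgroup_unit sX Xg.
rewrite -[X in same_axis _ X](conjrK _ Ug); apply: same_axis_conj.
have := mg (sigma^-1%g i); rewrite permKV.
by case=> ->; rewrite ?opprK; [left | right; rewrite opprK].
Qed.

Let moves_commutator g h sigma tau : X g -> X h -> moves g sigma -> moves h tau ->
  moves (commutator g h) (tau * (sigma * (tau^-1 * sigma^-1)))%g.
Proof.
move=> Xg Xh mg mh; have [Vg Vh] := (subgroupV sX Xg, subgroupV sX Xh).
have XVV : X (g^-1 * h^-1) by apply: subgroupM.
apply: movesM => //; first exact: subgroupM.
by apply: movesM => //; apply: movesM => //; apply: movesV.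
Qed.

(** Used twice along the derived series of [S_3]: from all permutations to the even ones, then to
    the identity. *)
Let derived_moves (P Q : {perm 'I_3} -> Prop) (H : D -> Prop) :
  (forall g, H g -> X g /\ exists2 sigma, P sigma & moves g sigma) ->
  (forall sigma tau, P sigma -> P tau -> Q (tau * (sigma * (tau^-1 * sigma^-1)))%g) ->
  Q 1%g -> (forall sigma tau, Q sigma -> Q tau -> Q (sigma * tau)%g) ->
  (forall sigma, Q sigma -> Q sigma^-1%g) ->
  forall g, derived H g -> X g /\ exists2 sigma, Q sigma & moves g sigma.
Proof.
move=> HP PQ Q1 QM QV g dg.
apply: (gen_le (H := fun g => X g /\ exists2 sigma, Q sigma & moves g sigma)) dg.
  split=> [x [Xx _]||x y [Xx [a Qa ma]] [Xy [b Qb mb]]|x [Xx [a Qa ma]]].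
  - exact: subgroup_unit Xx.
  - by split; [apply: subgroup1 | exists 1%g].
  - split; first exact: subgroupM.
    by exists (b * a)%g; [apply: QM | apply: movesM].
  split; first exact: subgroupV.
  by exists a^-1%g; [apply: QV | apply: movesV].
move=> _ [x [y [/HP [Xx [a Pa ma]] /HP [Xy [b Pb mb]] ->]]].
split; first exact: subgroup_commutator.
by exists (b * (a * (b^-1 * a^-1)))%g; [apply: PQ | apply: moves_commutator].
Qed.

Let alternating3_commute (a b : {perm 'I_3}) :
  odd_perm a = false -> odd_perm b = false -> (a * b = b * a)%g.
Proof.
have card3 : #|Alt 'I_3| = 3%N.
  have := @card_Alt 'I_3; rewrite card_ord => /(_ isT) /eqP.
  by rewrite -[(3`!)%N]/(2 * 3)%N eqn_mul2l => /eqP.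
have /cyclic_abelian/centsP cAlt : cyclic (Alt 'I_3) by apply: prime_cyclic; rewrite card3.
by move=> ea eb; apply: cAlt; rewrite Alt_even ?ea ?eb.
Qed.

(* [X] permutes the three axes [{s,-s}], [{t,-t}], [{st,-st}] through [S_3], which is metabelian;
   elements fixing every axis act by signs, hence commute on the axes. *)
Lemma third_derived_centralizes h : derived_iter 3 X h -> h * s = s * h /\ h * t = t * h.
Proof.
move=> X3h; have mX g : X g -> X g /\ exists2 sigma : {perm 'I_3}, True & moves g sigma.
  by move=> Xg; split=> //; have [sigma ms] := moves_exist Xg; exists sigma.
have mX1 g : derived X g -> X g /\ exists2 sigma, odd_perm sigma = false & moves g sigma.
  apply: derived_moves mX _ _ _ _ g => [a b _ _||a b ea eb|a ea].
  - by rewrite !odd_permM !odd_permV; case: odd_perm; case: odd_perm.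
  - exact: odd_perm1.
  - by rewrite odd_permM ea eb.
  - by rewrite odd_permV.
have mX2 g : derived_iter 2 X g -> X g /\ exists2 sigma, sigma = 1%g & moves g sigma.
  apply: derived_moves mX1 _ _ _ _ g => [a b ea eb||a b -> ->|a ->] //.
  - by rewrite mulgA (alternating3_commute eb ea) -invMg mulgV.
  - by rewrite mulg1.
  - by rewrite invg1.
suff fix_axis i : conjr h (axis i) = axis i.
  have Uh : h \is a GRing.unit.
    apply: (subgroup_unit sX); apply: (derived_iter_le (m := 3) (n := 0) sX).
    by rewrite addn0.
  by split; apply/conjr_fixP => //; [apply: (fix_axis (@Ordinal 3 0 isT)) |
    apply: (fix_axis (@Ordinal 3 1 isT))].
suff [] : X h /\ conjr h (axis i) = axis i by [].
have sign g : derived_iter 2 X g -> X g /\ same_axis (conjr g (axis i)) (axis i).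
  by move/mX2 => [Xg [_ -> mg]]; split=> //; have := mg i; rewrite perm1.
apply: (gen_le (H := fun h => X h /\ conjr h (axis i) = axis i)) X3h.
  split=> [x [Xx _]||x y [Xx fx] [Xy fy]|x [Xx fx]].
  - exact: subgroup_unit Xx.
  - by split; [apply: subgroup1 | rewrite conjr1].
  - split; first exact: subgroupM.
    by rewrite conjr_comp ?fy //; apply: subgroup_unit sX _.
  split; first exact: subgroupV.
  by rewrite -{1}fx conjrK //; apply: subgroup_unit Xx.
move=> _ [x [y [/sign [Xx fx] /sign [Xy fy] ->]]]; split; first exact: subgroup_commutator.
have [Ux Uy] := (subgroup_unit sX Xx, subgroup_unit sX Xy).
have -> : commutator x y = (y * x)^-1 * (x * y) by rewrite invrM // !mulrA.
have e : conjr (x * y) (axis i) = conjr (y * x) (axis i).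
  by rewrite !conjr_comp //; case: fx => fx; case: fy => fy; rewrite ?fy ?conjrN fx ?conjrN fy ?opprK.
by rewrite conjr_comp ?e ?conjrK // ?unitrV unitrMl.
Qed.

End QuaternionAction.

(** This is the form in which maximality enters the solvability argument. It holds for [M] when [D]
    has infinite dimension, and for the nonzero elements of any division subring by
    Cartan-Brauer-Hua. *)
Definition normal_subgroups_generate (D : unitRingType) (G : D -> Prop) : Prop :=
  forall N : D -> Prop, is_subgroup N -> (forall x, N x -> G x) -> normalized_by G N ->
    (forall x g, N x -> G g -> x * g = g * x) \/ (forall g, G g -> dgen N g).

(** * Displacements [h y h^-1 y^-1] of an element under conjugation *)

Section Displacement.
Variable D : unitRingType.
Implicit Types (x y z g h s t : D) (T X : D -> Prop).

Lemma nat_crossing (P : nat -> Prop) n : ~ P 0%N -> P n -> exists i, ~ P i /\ P i.+1.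
Proof.
move=> P0; elim: n => [//|n IHn] Pn1; case: (EM (P n)) => [/IHn //|nPn].
by exists n.
Qed.

(** As [X] centralizes the displacements of [y], the one of [g * k] is the product of those of [k]
    and [g]. These commute, so [x * z] and [z * x] move [y] alike and commutators fix it. *)
Lemma displacement_derived_fixed X y T : is_subgroup X ->
  (forall h, X h -> T (conjr h y * y^-1)) -> abelian_set T ->
  (forall h z, X h -> T z -> h * z = z * h) -> y \is a GRing.unit ->
  cent (derived X) y.
Proof.
move=> sX XT cT XcT Uy h dh; suff [] : X h /\ y * h = h * y by [].
apply: (gen_le (H := fun h => X h /\ y * h = h * y)) dh.
  split=> [x [Xx _]||x z [Xx cx] [Xz cz]|x [Xx cx]].
  - exact: subgroup_unit Xx.
  - by split; [apply: subgroup1 | rewrite mulr1 mul1r].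
  - by split; [apply: subgroupM | rewrite mulrA cx -mulrA cz mulrA].
  split; first exact: subgroupV.
  by apply: commrV.
move=> _ [x [z [Xx Xz ->]]]; split; first exact: subgroup_commutator.
have [Ux Uz] := (subgroup_unit sX Xx, subgroup_unit sX Xz).
have -> : commutator x z = (z * x)^-1 * (x * z) by rewrite invrM // !mulrA.
have conjE g : X g -> conjr g y = conjr g y * y^-1 * y by move=> Xg; rewrite divrK.
have conj2 g k : X g -> X k ->
    conjr (g * k) y = conjr k y * y^-1 * (conjr g y * y^-1) * y.
  move=> Xg Xk; have [Ug Uk] := (subgroup_unit sX Xg, subgroup_unit sX Xk).
  rewrite conjr_comp // {1}(conjE k Xk) conjrM //.
  have -> : conjr g (conjr k y * y^-1) = conjr k y * y^-1.
    by apply/conjr_fixP => //; apply: XcT => //; apply: XT.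
  by rewrite -[RHS]mulrA divrK.
apply/esym/conjr_fixP; first by rewrite unitrMl ?unitrV unitrMl.
have e : conjr (x * z) y = conjr (z * x) y.
  by rewrite !conj2 // (cT (conjr z y * y^-1)) //; apply: XT.
by rewrite conjr_comp ?unitrV ?unitrMl // e conjrK // unitrMl.
Qed.

End Displacement.
(** * Locally solvable groups whose noncentral normal subgroups generate *)

Section LocallySolvable.
Variables (D : unitRingType) (hD : is_division_ring D).
Implicit Types (x y z g h s t : D) (G H J N X Y A : D -> Prop).

Lemma class2_center_subgroup Y : is_subgroup Y -> is_subgroup (fun z => Y z /\ cent Y z).
Proof.
move=> sY; split=> [x [Yx _]||x y [Yx cx] [Yy cy]|x [Yx cx]].
- exact: subgroup_unit Yx.
- by split; [apply: subgroup1 | move=> y _; rewrite mul1r mulr1].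
- by split; [apply: subgroupM | move=> z Yz; rewrite -mulrA cy // mulrA cx // mulrA].
- by split; [apply: subgroupV | move=> z Yz; apply/esym/commrV/esym/cx].
Qed.

Lemma conj_quaternion_units Y G s t g u : is_subgroup Y ->
  (forall z, derived Y z -> cent Y z) -> is_subgroup G -> normalized_by G Y ->
  Y s -> Y t -> s ^+ 2 = -1 -> t ^+ 2 = -1 -> s * t = - (t * s) ->
  G g -> u \in quaternion_units s t -> conjr g u \in quaternion_units s t.
Proof.
move=> sY cY sG nY Ys Yt s2 t2 st Gg Qu; have Ug := subgroup_unit sG Gg.
have YN x : Y x -> Y (- x).
  by move=> Yx; rewrite -mulN1r -s2; apply: subgroupM => //; apply: subgroupX.
have Yst : Y (s * t) by apply: subgroupM.
have st2 : (s * t) ^+ 2 = -1.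
  by rewrite expr2 {1}st mulNr mulrA -(mulrA t) -expr2 s2 mulrN1 mulNr -expr2 t2 opprK.
have [Yu u2] : Y u /\ u ^+ 2 = -1.
  by move: Qu; rewrite !inE; do ![case/predU1P=> [->|] | move/eqP=> ->];
    rewrite ?sqrrN; split=> //; apply: YN.
apply: (quaternion_units_complete hD sY cY) => //; first exact: nY.
by rewrite -conjrX // u2 conjrN conjr_id.
Qed.

Lemma derived_generated_abelian H J : is_subgroup H -> (forall j, J j -> H j) ->
  let X := normal_closure H J in
  solvable_grp X -> (forall j, J j -> dgen (derived_iter 3 X) j) ->
  (forall x, X x -> algebraic_over_center x) -> abelian_set X.
Proof.
move=> sH JH X [n tX] JX algX; apply: contrapT => nab.
have UJ j : J j -> j \is a GRing.unit by move/JH; apply: subgroup_unit.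
have sX : is_subgroup X by apply: normal_closure_subgroup.
have nX : normalized_by H X by apply: normal_closure_normalized.
have XH x : X x -> H x by apply: normal_closure_le => // g y Hg; apply: subgroup_conj.
have nHX S : normalized_by H S -> normalized_by X S by move=> nS g x /XH; apply: nS.
have centX k x : (k <= 3)%N -> cent (derived_iter k X) x -> cent X x.
  move=> lek3 cx; apply: (cent_normal_closure hD sH UJ _ _ cx) => //.
    move=> j /JX; apply: dgen_mono => y; rewrite -(subnK lek3).
    exact: derived_iter_le.
  exact: derived_iter_normalized.
have abX A : abelian_set A -> normalized_by X A -> (forall a, A a -> X a) ->
    forall x a, X x -> A a -> x * a = a * x.
  move=> cA nA AX; apply: (abelian_normal_centralized hD sH JH) => //.
  - by exists n.
  - by move=> j /JX; apply: dgen_mono => y; apply: (derived_iter_le (m := 2) (n := 1) sX).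
  - by move=> a /AX; apply: algX.
clearbody X.
(* [Y] is the last nonabelian term of the derived series; its derived subgroup is abelian and
   normal, so [X] centralizes it and [Y] has class two. *)
have [i [nYab Y'ab]] : exists i, ~ abelian_set (derived_iter i X) /\
    abelian_set (derived_iter i.+1 X).
  apply: (@nat_crossing _ n) => // x y /tX -> /tX -> //.
set Y := derived_iter i X in nYab; have sY : is_subgroup Y by apply: derived_iter_subgroup.
have nY : normalized_by X Y by apply: derived_iter_normal.
have YX y : Y y -> X y by move=> Yy; apply: (derived_iter_le (m := i) (n := 0) sX); rewrite addn0.
have cY z : derived Y z -> cent Y z.
  move=> Y'z y /YX Xy; apply/esym/(abX (derived Y)) => //.
    exact: derived_normalized.
  by move=> x /(derived_le sY) /YX.
have cZ z : Y z -> cent Y z -> cent X z.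
  move=> Yz cz x Xx; apply/esym/(abX (fun z => Y z /\ cent Y z)) => //.
  - by move=> u v [Yu cu] [Yv _]; apply: cu.
  - by move=> g u Xg [Yu cu]; split; [apply: nY | apply: cent_normalized Xg cu].
  - by move=> u [/YX].
have [Tab|nTab] := EM (abelian_set (torsion Y)).
  (* All displacements of an element of [Y] lie in the torsion of [Y], which [X] centralizes; hence
     [X'] centralizes [Y], and so does [X]. *)
  apply: nYab => x y Yx Yy; apply: (centX 1%N) => //; last exact: YX.
  apply: (displacement_derived_fixed (T := torsion Y)) => //.
  - move=> h Xh; apply: (displacement_torsion hD sY cY sX) => //.
    by apply/algX/YX.
  - move=> h z Xh Tz; apply: (abX (torsion Y)) => //; first exact: torsion_normalized.
    by move=> u [/YX].
  exact: subgroup_unit Yx.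
have [s [t [Ys Yt [s2 t2] st nst]]] := torsion_quaternion hD sY cY nTab.
have [Us Ut] := (subgroup_unit sY Ys, subgroup_unit sY Yt).
have fix_st := third_derived_centralizes sX Us Ut nst (fun g u =>
  conj_quaternion_units sY cY sX nY Ys Yt s2 t2 st).
case/eqP: nst; apply: (centX 3%N) => //; last exact: YX.
by move=> h /fix_st [].
Qed.

Section Generating.
Variable G : D -> Prop.
Hypotheses (sG : is_subgroup G) (lsG : locally_solvable G).
Hypothesis algG : set_algebraic_over_center (derived G).
Hypothesis genG : normal_subgroups_generate G.

(** [z] lies in the third derived subgroup [N] of the normal closure of a finite subset [J] of [G'].
    If [N] generates, finitely many elements of [G] suffice to put [J] in the division subring. Over
    the subgroup [H] they generate, the normal closure of [J] is solvable, hence abelian, and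
    [z = 1]. *)
Lemma fourth_derived_central z g : derived_iter 4 G z -> G g -> z * g = g * z.
Proof.
move=> G4z Gg; have sG' := derived_subgroup sG.
have [J [JG' JG3z]] : fg_witnessed (derived G) (fun H => derived_iter 3 H) z.
  apply: (fg_derived_iter (n := 3) (P := fun H => H)) => //; first by move=> S T x; apply.
  move: G4z; rewrite -(derived_iterD 3 1); apply: derived_iter_mono => y G'y.
  exists [:: y]; split; first by move=> x; rewrite inE => /eqP ->.
  by apply: gen_sub; rewrite mem_head.
have JG j : j \in J -> G j by move/JG'; apply: derived_le.
pose Jp (j : D) : Prop := j \in J; have UJ j : Jp j -> j \is a GRing.unit.
  by move/JG; apply: subgroup_unit.
have sX : is_subgroup (normal_closure G Jp) by apply: normal_closure_subgroup.
have nX : normalized_by G (normal_closure G Jp) by apply: normal_closure_normalized.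
have XG x : normal_closure G Jp x -> G x.
  by apply: normal_closure_le => // h y Gh; apply: subgroup_conj.
pose N := derived_iter 3 (normal_closure G Jp).
have sN : is_subgroup N by apply: derived_iter_subgroup.
have NG x : N x -> G x.
  by move=> Nx; apply: XG; exact: (@derived_iter_le _ 3 0 _ _ sX Nx).
have zN : N z.
  apply: derived_iter_mono JG3z => y; apply: gen_le => // j Jj.
  exact: normal_closure_sub.
case: (genG sN NG) => [|cN|gN]; [exact: derived_iter_normalized | exact: cN |].
case: (eqVneq z 1) => [->|z1]; first by rewrite mul1r mulr1.
have mono_dgen : monotone (fun H => dgen (derived_iter 3 (normal_closure H Jp))).
  by move=> S T x ST; apply: dgen_mono => y; apply: derived_iter_mono => w;
    apply: normal_closure_mono.
have [s [Gs sJ]] : exists s : seq D, (forall x, x \in s -> G x) /\ forall j, j \in J ->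
    dgen (derived_iter 3 (normal_closure (gen (fun x => x \in s)) Jp)) j.
  apply: (fg_seq mono_dgen) => j Jj.
  apply: (fg_dgen (P := fun H => derived_iter 3 (normal_closure H Jp)) sG).
    by move=> S T x ST; apply: derived_iter_mono => w; apply: normal_closure_mono.
  by apply: dgen_mono (gN _ (JG _ Jj)) => y; apply: normal_closure_fg.
have [r [Gr rz]] := normal_closure_fg sG UJ zN.
(* [s] puts [J] in the division subring, [r] puts [z] in the third derived subgroup, and [J] makes
   the normal closure a subgroup of [H]. *)
pose l := s ++ r ++ J; pose H := gen (fun x => x \in l).
have Gl x : x \in l -> G x by rewrite !mem_cat => /or3P [/Gs|/Gr|/JG].
have sH : is_subgroup H by apply: fg_subgroup sG Gl.
have HG x : H x -> G x by apply: fg_le.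
have JH j : Jp j -> H j by move=> Jj; apply: gen_sub; rewrite !mem_cat; apply/or3P/Or33.
have XH x : normal_closure H Jp x -> H x.
  by apply: normal_closure_le => // h y Hh; apply: subgroup_conj.
have abX : abelian_set (normal_closure H Jp).
  apply: derived_generated_abelian => //.
  - have [n tH] := lsG Gl; exists n => x Xx; apply: tH.
    by apply: derived_iter_mono Xx.
  - move=> j /sJ; apply: mono_dgen => y; apply: gen_mono => x xs.
    by rewrite mem_cat xs.
  move=> x Xx; apply: algG; move: Xx; apply: normal_closure_le => //.
  by move=> h y /HG; apply: (derived_iter_normal hD (n := 1) sG).
case/eqP: z1; have : derived_iter 3 (normal_closure H Jp) z.
  apply: derived_iter_mono rz => y; apply: normal_closure_mono => x.
  by apply: gen_mono => w wr; rewrite !mem_cat wr orbT.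
move/(derived_iter_le (m := 2) (n := 1) (normal_closure_subgroup sH UJ)).
by apply: derived_trivial => //; apply: normal_closure_subgroup.
Qed.

Hypothesis nabG : ~ abelian_set G.

(** [A] cannot generate, since [F(A)] is commutative and [G] is not. *)
Lemma abelian_normal_central A x g : is_subgroup A -> (forall a, A a -> G a) ->
  normalized_by G A -> abelian_set A -> A x -> G g -> x * g = g * x.
Proof.
move=> sA AG nA cA Ax Gg; case: (genG sA AG nA) => [cent_A|gA]; first exact: cent_A.
by case: nabG => u v /gA Gu /gA Gv; apply: (dgen_abelian hD cA).
Qed.

(** Conjugation changes [y] only by factors in the center of [G], so [y] and this center generate an
    abelian normal subgroup. *)
Lemma central_displacement_central y g : G y ->
  (forall h k, G h -> G k -> conjr h y * y^-1 * k = k * (conjr h y * y^-1)) ->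
  G g -> y * g = g * y.
Proof.
move=> Gy cy Gg; pose Z z := G z /\ cent G z.
have sZ : is_subgroup Z by apply: class2_center_subgroup.
have Uy := subgroup_unit sG Gy.
pose S x := Z x \/ exists2 c, Z c & x = c * y.
have SG x : S x -> G x.
  by case=> [[]//|[c [Gc _] ->]]; apply: subgroupM.
have cS : abelian_set S.
  move=> u v [[_ cu]|[c [Gc cc] ->]] Sv; first by apply: cu; apply: SG.
  case: Sv => [[Gv cv]|[d [Gd cd] ->]]; first by apply/esym/cv; apply: subgroupM.
  by rewrite mulrA -(cd _ (subgroupM sG Gc Gy)) [RHS]mulrA -[d * y * c]mulrA -(cc _ Gy).
have nS : normalized_by G S.
  have Zfix h c : G h -> Z c -> conjr h c = c.
    by move=> Gh [_ cc]; apply/conjr_fixP; [apply: subgroup_unit Gh | rewrite cc].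
  move=> h u Gh [Zu|[c Zc ->]]; first by left; rewrite Zfix.
  right; exists (c * (conjr h y * y^-1)).
    apply: subgroupM => //; split; last by move=> k; apply: cy.
    by apply: subgroupM; rewrite //; [apply: subgroup_conj | apply: subgroupV].
  by rewrite conjrM ?(subgroup_unit sG) // Zfix // -[RHS]mulrA divrK.
have US u : S u -> u \is a GRing.unit by move/SG; apply: subgroup_unit.
apply: (abelian_normal_central (A := gen S)) => //.
- exact: gen_subgroup.
- by move=> u; apply: gen_le.
- by move=> h u Gh; apply: (gen_conj hD); [apply: subgroup_unit Gh | move=> v; apply: nS].
- move=> u v /(gen_dgen hD US) Su /(gen_dgen hD US) Sv; exact: (dgen_abelian hD cS).
- by apply: gen_sub; right; exists 1; [apply: subgroup1 | rewrite mul1r].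
Qed.

Theorem locally_solvable_quaternion : exists s t,
  [/\ G s, G t, s ^+ 2 = -1 /\ t ^+ 2 = -1, s * t = - (t * s) /\ s * t != t * s
    & forall g u, G g -> u \in quaternion_units s t -> conjr g u \in quaternion_units s t].
Proof.
pose P i := forall z g, derived_iter i G z -> G g -> z * g = g * z.
have [i [nPi Pi1]] : exists i, ~ P i /\ P i.+1.
  apply: (@nat_crossing _ 4) => [P0|z g]; last exact: fourth_derived_central.
  by apply: nabG => x y; apply: P0.
case: i nPi Pi1 => [|i] nPi Pi1.
  (* If [G'] is central, every displacement is a commutator and thus central. *)
  case: nPi => z g Gz; apply: central_displacement_central => // h k Gh Gk.
  have -> : conjr h z * z^-1 = commutator h^-1 z^-1 by rewrite /commutator !invrK.
  by apply: Pi1 => //; apply: derived_commutator; apply: subgroupV.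
set N := derived_iter i.+1 G in nPi.
have sN : is_subgroup N by apply: derived_iter_subgroup.
have nN : normalized_by G N by apply: derived_iter_normal.
have NG' x : N x -> derived G x.
  by move=> Nx; apply: (derived_iter_le (m := i) (n := 1) sG); rewrite addn1.
have NG x : N x -> G x by move/NG'; apply: derived_le.
have cN z : derived N z -> cent N z by move=> N'z y /NG; apply: Pi1.
have sT := torsion_subgroup sN cN.
have nT : normalized_by G (torsion N) by apply: torsion_normalized.
have TG x : torsion N x -> G x by case=> /NG.
have cZ z : N z -> cent N z -> cent G z.
  move=> Nz cz g Gg; apply: (abelian_normal_central (A := fun z => N z /\ cent N z)) => //.
  - exact: class2_center_subgroup.
  - by move=> u [/NG].
  - by move=> h u Gh [Nu cu]; split; [apply: nN | apply: cent_normalized Gh cu].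
  - by move=> u v [_ cu] [Nv _]; apply: cu.
(* Abelian torsion would be central, so the displacements of every [y] in [N] would be central, and
   hence [y] itself. *)
have nTab : ~ abelian_set (torsion N).
  move=> Tab; apply: nPi => y g Ny Gg.
  apply: central_displacement_central => //; first exact: NG.
  move=> h k Gh Gk; apply: (abelian_normal_central (A := torsion N)) => //.
  by apply: (displacement_torsion hD sN cN sG) => //; apply: algG; apply: NG'.
have [s [t [Ns Nt [s2 t2] st nst]]] := torsion_quaternion hD sN cN nTab.
exists s, t; split=> //; [exact: NG | exact: NG |].
by move=> g u; apply: (conj_quaternion_units sN cN sG nN).
Qed.

End Generating.
End LocallySolvable.
(** * Division rings with a quaternion basis *)

Section QuaternionFiniteDimension.
Variables (D : unitRingType) (hD : is_division_ring D) (s t : D).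
Hypotheses (s2 : s ^+ 2 = -1) (t2 : t ^+ 2 = -1).
Hypotheses (st : s * t = - (t * s)) (nst : s * t != t * s).
Implicit Types (x y d : D).

Let two_neq0 : (1 + 1 : D) != 0.
Proof.
apply: contraNneq nst => e; apply/eqP; rewrite st; apply/eqP.
by rewrite eq_sym -addr_eq0 -[X in X + X]mul1r -mulrDl e mul0r.
Qed.

Let double_eq0 x : x + x = 0 -> x = 0.
Proof.
rewrite -[X in X + X]mul1r -mulrDl => /(mulr_eq0P hD) [/eqP|//].
by rewrite (negPf two_neq0).
Qed.

Let ss : s * s = -1. Proof. by rewrite -expr2. Qed.
Let tt : t * t = -1. Proof. by rewrite -expr2. Qed.
Let ts : t * s = - (s * t). Proof. by rewrite st opprK. Qed.
Let ssx x : s * (s * x) = - x. Proof. by rewrite mulrA ss mulN1r. Qed.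
Let ttx x : t * (t * x) = - x. Proof. by rewrite mulrA tt mulN1r. Qed.
Let tsx x : t * (s * x) = - (s * (t * x)). Proof. by rewrite !mulrA ts mulNr. Qed.
Let mulA x y d : x * y * d = x * (y * d). Proof. by rewrite mulrA. Qed.
(** Rewriting with [qE] expands products and brings words to a right-associated form with [s] before
    [t] and squares replaced by -1. *)
Let qE := (@mulrDl D, @mulrDr D, @mulrN D, @mulNr D, @opprK D, @opprD D, @mulr1 D, @mul1r D,
  mulA, ss, tt, ts, ssx, ttx, tsx).

(** In characteristic zero the conjugate is [(3 t + 4 s t) / 5]. Comparing each candidate [u] with
    [u (2 + s) = 2 t + s t] covers positive characteristic too. *)
Lemma quaternion_not_normal : conjr (1 + 1 + s) t \notin quaternion_units s t.
Proof.
have Us : s \is a GRing.unit by rewrite -(unitrX_pos _ (isT : 0 < 2)%N) s2 unitrN unitr1.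
have Ut : t \is a GRing.unit by rewrite -(unitrX_pos _ (isT : 0 < 2)%N) t2 unitrN unitr1.
have ncs x : x * t = t * x -> s = x -> False by move=> ct e; case/eqP: nst; rewrite e.
have g0 : (1 + 1 + s) != 0.
  apply/eqP => e; apply: (ncs (- (1 + 1))); first by rewrite !qE.
  by apply/eqP; rewrite -addr_eq0 addrC e.
have gt : conjr (1 + 1 + s) t * (1 + 1 + s) = t + t + s * t.
  by rewrite /conjr divrK ?hD // !qE.
move: (conjr _ _) gt => u gt; apply/negP; rewrite !inE.
have tts0 : t + t + s * t <> 0.
  have -> : t + t + s * t = (1 + 1 + s) * t by rewrite !qE.
  by move/(mulr_eq0P hD) => [/eqP|t0]; [rewrite (negPf g0) | rewrite t0 unitr0 in Ut].
have st0 : s * t <> 0 by move/(mulr_eq0P hD) => [] e; [move: Us | move: Ut]; rewrite e unitr0.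
have t0 : t <> 0 by move=> e; rewrite e mulr0 in st0.
have double_st : s * t + s * t <> 0 by move/double_eq0.
have anti_s : s * (t + t + s * t) = - ((t + t + s * t) * s) by rewrite !qE.
have not_comm_s : u * s = s * u -> False.
  move=> us; apply: tts0; have e : s * (t + t + s * t) = (t + t + s * t) * s.
    by rewrite -gt mulrA -us -!mulrA; congr (u * _); rewrite !qE.
  have /(congr1 (fun x => x * s^-1)) : (t + t + s * t) * s = 0.
    by apply: double_eq0; rewrite -{1}e anti_s addNr.
  by rewrite mulrK // mul0r.
do 5?[case/orP]; move/eqP => uE.
- by apply: not_comm_s; rewrite uE.
- by apply: not_comm_s; rewrite uE !qE.
- move: gt; rewrite uE !qE => /addrI /eqP; rewrite eq_sym -addr_eq0 => /eqP.
  exact: double_st.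
- move: gt; rewrite uE !qE => /addIr /eqP; rewrite eq_sym -subr_eq0 !opprD !opprK => /eqP e.
  by apply/t0/double_eq0/double_eq0.
- move: gt; rewrite uE !qE -[RHS]addrA [t + s * t]addrC addrA => /addIr.
  rewrite [RHS]addrC => /addrI; rewrite -[RHS]mul1r => /(mulIr Ut); apply: ncs.
  by rewrite !qE.
have e3 : (1 + 1 + 1) * ((1 + s) * t) = 0.
  move: gt; rewrite uE !qE => /(congr1 (fun x => x + t + s * t + s * t)).
  rewrite !subrK addNr => e; rewrite !addrA [LHS](ACl (1*3*2*5*4*6)) /=.
  exact: esym e.
case/(mulr_eq0P hD): e3 => [e3|/(mulr_eq0P hD) [/eqP|//]]; last first.
  rewrite addr_eq0 => /eqP e; apply: (ncs (-1)); first by rewrite !qE.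
  by rewrite e opprK.
(* In characteristic three [(s + t) ^+ 2 = -2 = 1], so [s + t] is 1 or -1 and [s] would commute with
   [t]. *)
have : (s + t) ^+ 2 = 1.
  rewrite expr2 !qE addrA addrK; apply/eqP.
  by rewrite -opprD eq_sym -addr_eq0 addrA e3.
case/(sqr_eq1 hD) => e.
  by apply: (ncs (1 - t)); [rewrite !qE | rewrite -e addrK].
by apply: (ncs (- 1 - t)); [rewrite !qE | rewrite -e addrK].
Qed.

(** When [y * y = -1], conjugation by [y] is the involution sending [x] to [- y x y]; the two
    summands project [2 x] to its eigenspaces. *)
Let split_half x y : x = (1 + 1)^-1 * ((x - y * x * y) + (x + y * x * y)).
Proof.
rewrite addrACA addNr addr0 (_ : x + x = (1 + 1) * x) ?mulKr //; last by rewrite mulrDl mul1r.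
exact/hD/two_neq0.
Qed.

Let comm_part x y : y * y = -1 -> (x - y * x * y) * y = y * (x - y * x * y).
Proof.
move=> y2; rewrite mulrBl mulrBr -[y * x * y * y]mulrA y2 mulrN1 opprK.
by rewrite !mulrA y2 mulN1r mulNr opprK addrC.
Qed.

Let anti_part x y : y * y = -1 -> (x + y * x * y) * y = - (y * (x + y * x * y)).
Proof.
move=> y2; rewrite mulrDl mulrDr -[y * x * y * y]mulrA y2 mulrN1.
by rewrite !mulrA y2 mulN1r mulNr opprD opprK addrC.
Qed.

(** Split [x] into parts commuting and anticommuting with [s]; the second becomes commuting after
    multiplication by [t]. Splitting the centralizer of [s] in the same way by [t] gives
    [F + F s]. *)
Lemma quaternion_finite_dim :
  (forall x, x * s = s * x -> x * t = t * x -> center x) -> finite_dim_over_center D.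
Proof.
move=> cst; have dF := cent_division_subring hD (fun _ : D => True).
have cF x : cent (fun _ : D => True) x -> center x by move=> cx y; apply: cx.
have Fc x : center x -> cent (fun _ : D => True) x by move=> cx y _; apply: cx.
have c2 : center ((1 + 1 : D)^-1).
  by apply: cF; apply: (divsubV dF); apply: (divsubD dF); apply: (divsub1 dF).
have cM x y : center x -> center y -> center (x * y).
  by move=> /Fc cx /Fc cy; apply: cF; apply: (divsubM dF).
have cN x : center x -> center (- x) by move=> /Fc cx; apply: cF; apply: (divsubN dF).
have cent_s x : x * s = s * x -> exists a b, [/\ center a, center b & x = a + b * s].
  move=> xs; pose p := x - t * x * t; pose q := x + t * x * t.
  have txts : t * x * t * s = s * (t * x * t).
    by rewrite !qE (mulrA x) xs !qE.
  have cp : center p.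
    by apply: cst; [rewrite mulrBl mulrBr txts xs | apply: comm_part].
  have qs : q * s = s * q by rewrite mulrDl mulrDr txts xs.
  have qt := anti_part x tt; rewrite -/q in qt.
  have cqs : center (q * s).
    apply: cst; first by rewrite mulrA -qs.
    by rewrite -[LHS]mulrA st mulrN [q * (t * s)]mulrA qt mulNr opprK mulrA.
  exists ((1 + 1)^-1 * p), (- ((1 + 1)^-1 * (q * s))); split; [exact: cM | by apply/cN/cM |].
  by rewrite {1}(split_half x t) -/p -/q mulrDr mulNr -!mulrA ss !mulrN1 !mulrN opprK.
exists [:: 1; s; t; s * t] => x.
pose p := x - s * x * s; pose q := x + s * x * s.
have ps : p * s = s * p by apply: comm_part.
have qs : q * s = - (s * q) by apply: anti_part.
have qts : (q * t) * s = s * (q * t).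
  by rewrite -[LHS]mulrA ts mulrN [q * (s * t)]mulrA qs mulNr opprK mulrA.
have [a [b [ca cb e]]] := cent_s _ ps; have [c [d [cc cd e']]] := cent_s _ qts.
have h := cM _ _ c2; exists [:: (1 + 1)^-1 * a; (1 + 1)^-1 * b;
  - ((1 + 1)^-1 * c); - ((1 + 1)^-1 * d)]; split=> [i|].
  case: i => [|[|[|[|i]]]] /=; [exact: h | exact: h | exact/cN/h | exact/cN/h |].
  by rewrite nth_nil => y; rewrite mul0r mulr0.
rewrite !big_ord_recl big_ord0 /= addr0 mulr1 {1}(split_half x s) -/p -/q e mulrDr mulrDr.
rewrite -!addrA !mulrA; congr (_ + (_ + _)).
have -> : q = - (q * t * t) by rewrite -mulrA tt mulrN1 opprK.
by rewrite e' mulrN mulrDl mulrDr opprD !mulNr !mulrA.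
Qed.

End QuaternionFiniteDimension.
(** * Maximal subgroups *)

Section MaximalSubgroup.
Variables (D : unitRingType) (hD : is_division_ring D).
Implicit Types (x y z g h d : D) (E R N A M : D -> Prop).

Lemma locally_solvable_division_subring_abelian E M : division_subring E ->
  locally_solvable M -> set_algebraic_over_center (derived M) ->
  (forall x, E x -> x != 0 -> M x) -> abelian_set E.
Proof.
move=> dE lsM algM EM'; pose G x := E x /\ x != 0.
have sG : is_subgroup G by apply: nonzero_subgroup.
have GM x : G x -> M x by case; apply: EM'.
have lsG : locally_solvable G by move=> l Gl; apply: lsM => x /Gl /GM.
have algG : set_algebraic_over_center (derived G).
  by move=> x G'x; apply: algM; apply: derived_mono G'x.
have genG : normal_subgroups_generate G.
  move=> N sN NG nN; have NE x : dgen N x -> E x by apply: dgen_le => // y /NG [].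
  case: (cartan_brauer_hua hD (dgen_division_subring N) dE NE).
  - by move=> g x Eg g0; apply: (dgen_normalized hD sG nN).
  - by move=> EN; right=> g [/EN].
  - by move=> cN; left=> x g Nx [Eg _]; apply: cN => //; apply: dgen_sub.
have [abG|nabG] := EM (abelian_set G).
  move=> x y Ex Ey; case: (eqVneq x 0) => [->|x0]; first by rewrite mul0r mulr0.
  by case: (eqVneq y 0) => [->|y0]; [rewrite mul0r mulr0 | apply: abG].
have [s [t [[Es _] [Et _] [s2 t2] [st nst] nQ]]] :=
  locally_solvable_quaternion hD sG lsG algG genG nabG.
have := quaternion_not_normal hD s2 t2 st nst; rewrite nQ //; last first.
  by rewrite !inE eqxx !orbT.
have E2 : E (1 + 1) by apply: divsubD => //; apply: divsub1.
split; first exact: divsubD.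
apply: contraNneq nst => e; have -> : s = - (1 + 1) by apply/eqP; rewrite -addr_eq0 addrC e.
by rewrite mulrN mulNr mulrDl mulrDr mul1r mulr1.
Qed.

(** The products of elements of [M] and nonzero elements of [R] form a subgroup containing [M]. If
    it equals [M], then [M] contains the nonzero elements of [R]; otherwise all units normalize [R]
    and Cartan-Brauer-Hua applies. *)
Lemma maximal_normalized_division_subring M R : maximal_subgroup M ->
  division_subring R -> normalized_by M R ->
  [\/ forall x, R x -> x != 0 -> M x, forall x, R x | forall x, R x -> center x].
Proof.
case=> sM _ maxM dR nR; have UM := fun x => @subgroup_unit D M x sM.
pose H x := exists m r, [/\ M m, R r, r != 0 & x = m * r].
have sH : is_subgroup H.
  split=> [_ [m [r [/UM Um Rr /hD Ur ->]]]||_ _ [m [r [Mm Rr r0 ->]]] [m' [r' [Mm' Rr' r0' ->]]]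
      |_ [m [r [Mm Rr r0 ->]]]].
  - by rewrite unitrMl.
  - exists 1, 1; split; rewrite ?mulr1 ?oner_neq0 //; [exact: subgroup1 | exact: divsub1].
  - have Um' := UM _ Mm'; have Vm' := subgroupV sM Mm'.
    exists (m * m'), (conjr m'^-1 r * r'); split; first exact: subgroupM.
    + by apply: divsubM => //; apply: nR.
    + apply: mulr_neq0 => //; apply/unitr_neq0/unitr_conj; first exact: UM.
      exact: hD.
    + by rewrite /conjr invrK -!mulrA mulVKr.
  have Um := UM _ Mm; exists m^-1, (conjr m r^-1); split; first exact: subgroupV.
  - by apply: nR => //; apply: divsubV.
  - by apply/unitr_neq0/unitr_conj; rewrite // unitrV; apply: hD.
  - by rewrite /conjr (invrM Um (hD r0)) -!mulrA mulKr.
case: (maxM _ sH) => [m Mm|HM|UH].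
- exists m, 1; split; rewrite ?mulr1 ?oner_neq0 //; exact: divsub1.
- apply: Or31 => x Rx x0; apply: HM; exists 1, x; split; rewrite ?mul1r //.
  exact: subgroup1.
case: (cartan_brauer_hua hD dR (setT_division_subring D)) => [//|g x _ /hD /UH|allR|cR].
- move=> [m [r [Mm Rr r0 ->]]] Rx; rewrite (conjr_comp _ (UM _ Mm) (hD r0)).
  by apply: nR => //; apply: divsub_conj.
- by apply: Or32 => x; apply: allR.
- by apply: Or33 => x Rx y; apply: cR.
Qed.

Lemma finite_dim_of_family (I : Type) (r : seq I) (e : I -> D) (i0 : I) :
  (forall d, exists2 c : I -> D, (forall i, center (c i)) & d = \sum_(i <- r) c i * e i) ->
  finite_dim_over_center D.
Proof.
move=> span; exists [seq e i | i <- r] => d; have [c cc ->] := span d.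
exists [seq c i | i <- r]; split=> [i|].
  have [ltir|leri] := ltnP i (size r); first by rewrite (nth_map i0).
  by rewrite nth_default ?size_map // => y; rewrite mul0r mulr0.
rewrite (big_nth i0) big_mkord size_map; apply: eq_bigr => i _.
by rewrite !(nth_map i0).
Qed.

Section LocallySolvableMaximal.
Variable M : D -> Prop.
Hypotheses (maxM : maximal_subgroup M) (nabM : nonabelian M).
Hypotheses (lsM : locally_solvable M) (algM : set_algebraic_over_center (derived M)).

Let sM : is_subgroup M. Proof. by case: maxM. Qed.
Let UM x : M x -> x \is a GRing.unit. Proof. exact: subgroup_unit. Qed.
Let nabM' : ~ abelian_set M.
Proof. by case: nabM => x [y [Mx My /eqP nxy]] abM; apply/nxy/abM. Qed.

(** [F(M)] is [D]: the other two cases of the trichotomy would make [M] abelian. *)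
Lemma maximal_cent_center x : cent M x -> center x.
Proof.
move=> cx; have nR : normalized_by M (dgen M).
  by apply: dgen_normalized => // g y; apply: subgroup_conj.
case: (maximal_normalized_division_subring maxM (dgen_division_subring M) nR) => [RM|allR|cR].
- case: nabM' => y z My Mz.
  apply: (locally_solvable_division_subring_abelian (dgen_division_subring M) lsM algM RM);
  exact: dgen_sub.
- by move=> y; apply: (cent_dgen hD cx).
- by case: nabM' => y z My _; apply: cR; apply: dgen_sub.
Qed.

(* With [O] the orbit of [a] and [C] its centralizer, [C] is a field on which [M] acts with
   fixed field the center [F] through the finite group [M / C]; [D] is spanned by
   representatives of [M / C] over [C], and [C] is finite over [F] by Artin's theorem.
   Both are made explicit by a dual family [(l, k)]: [c = sum Tr(c l) k] on [C], and
   [P d = sum k d l] maps [D] to [C] with [d = sum_w P(d w) w^-1]. *)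
Lemma finite_dim_of_abelian_normalized A a : abelian_set A -> normalized_by M A ->
  A a -> algebraic_over_center a -> ~ center a -> finite_dim_over_center D.
Proof.
move=> cA nA Aa alga nca.
have [O [UO OP]] : exists O : seq D,
    uniq O /\ forall x, x \in O <-> exists2 g, M g & x = conjr g a.
  by apply: finite_orbit => // g h Mg Mh; apply: cA; apply: nA.
have nO g x : M g -> x \in O -> conjr g x \in O.
  move=> Mg /OP [h Mh ->]; apply/OP; exists (g * h); first exact: subgroupM.
  by rewrite conjr_comp // UM.
have AO x : x \in O -> A x by case/OP => g Mg ->; apply: nA.
have aO : a \in O by apply/OP; exists 1; [apply: subgroup1 | rewrite conjr1].
pose C := cent (fun x => x \in O).
have dC : division_subring C by apply: cent_division_subring.
have OC x : x \in O -> C x by move=> /AO Ax y /AO Ay; apply: cA.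
have nC : normalized_by M C by apply: cent_normalized => // g x; apply: nO.
have cC : abelian_set C.
  case: (maximal_normalized_division_subring maxM dC nC) => [CM|allC|cenC].
  - exact: locally_solvable_division_subring_abelian CM.
  - by case: nca => y; apply/esym/allC.
  - by case: nca; apply/cenC/OC.
have [ws [wsM sum_ws]] := coset_representatives sM UO nO.
pose us := [seq w <- ws | ~~ `[< {in O, conjr w =1 id} >]].
have usM u : u \in us -> M u by rewrite mem_filter => /andP [_ /wsM].
have [lk [Clk lk1 lk0]] : exists lk : seq (D * D),
    [/\ forall p, p \in lk -> C p.1 /\ C p.2,
        \sum_(p <- lk) p.1 * p.2 = 1
      & forall u, u \in us -> \sum_(p <- lk) conjr u p.1 * p.2 = 0].
  apply: dual_family => // [u y /usM|u /usM|u]; [exact: nC | exact: UM |].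
  rewrite mem_filter => /andP [/asboolPn nu _].
  apply: contrapT => nl; apply: nu => y yO; apply: contrapT => /eqP ny.
  by apply: nl; exists y => //; apply: OC.
have lk0' w : w \in ws -> ~ {in O, conjr w =1 id} ->
    \sum_(p <- lk) conjr w p.1 * p.2 = 0.
  by move=> wws nw; apply: lk0; rewrite mem_filter wws andbT; apply/asboolPn.
have agreeC g h c : M g -> M h -> {in O, conjr g =1 conjr h} -> C c -> conjr g c = conjr h c.
  move=> Mg Mh e Cc; have [Ug Uh] := (UM Mg, UM Mh).
  have Uhg : h^-1 * g \is a GRing.unit by rewrite unitrMl ?unitrV.
  have -> : conjr g c = conjr h (conjr (h^-1 * g) c).
    by rewrite conjr_comp ?unitrV // conjrKV.
  congr conjr; apply/conjr_fixP => //; apply: cC => // y yO; apply/conjr_fixP => //.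
  by rewrite conjr_comp ?unitrV // e // conjrK.
pose Tr c := \sum_(w <- ws) conjr w c.
have center_Tr c : C c -> center (Tr c).
  move=> Cc; apply: maximal_cent_center => g Mg; apply/esym/conjr_fixP; first exact: UM.
  have [sum_gw _] := sum_ws (fun w => conjr w c) (fun g h Mg Mh e => agreeC g h c Mg Mh e Cc).
  rewrite /Tr conjr_sum -[RHS](sum_gw _ Mg) big_seq [RHS]big_seq.
  by apply: eq_bigr => w /wsM Mw; rewrite conjr_comp // UM.
have TrE c : C c -> c = \sum_(p <- lk) Tr (c * p.1) * p.2.
  move=> Cc; pose phi w := conjr w c * \sum_(p <- lk) conjr w p.1 * p.2.
  have -> : \sum_(p <- lk) Tr (c * p.1) * p.2 = \sum_(w <- ws) phi w.
    under eq_bigr => p _ do rewrite mulr_suml.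
    rewrite exchange_big /= big_seq [RHS]big_seq; apply: eq_bigr => w /wsM Mw.
    by rewrite /phi mulr_sumr; apply: eq_bigr => p _; rewrite conjrM ?UM // mulrA.
  have [|_ ->] := sum_ws phi.
  - move=> g h Mg Mh e; rewrite /phi (agreeC g h c) //; congr (_ * _).
    rewrite big_seq [RHS]big_seq; apply: eq_bigr => p /Clk [Cp _].
    by rewrite (agreeC g h).
  - rewrite /phi conjr1; under eq_bigr => p _ do rewrite conjr1.
    by rewrite lk1 mulr1.
  by move=> w wws nw; rewrite /phi lk0' // mulr0.
(* A tensor in [C (x)_F C] killed by all [1 (x) w] vanishes. *)
have tensor0 (q : seq (D * D)) d : (forall p, p \in q -> C p.2) ->
    (forall w, w \in ws -> \sum_(p <- q) p.1 * conjr w p.2 = 0) ->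
    \sum_(p <- q) p.1 * d * p.2 = 0.
  move=> Cq q0.
  have -> : \sum_(p <- q) p.1 * d * p.2
      = \sum_(r <- lk) (\sum_(p <- q) p.1 * Tr (p.2 * r.1)) * d * r.2.
    under [RHS]eq_bigr => r _ do rewrite mulr_suml mulr_suml.
    rewrite exchange_big /= big_seq [RHS]big_seq; apply: eq_bigr => p /Cq Cp.
    rewrite {1}(TrE _ Cp) mulr_sumr big_seq [RHS]big_seq; apply: eq_bigr => r /Clk [Cr _].
    rewrite !mulrA -!mulrA; congr (_ * _); rewrite !mulrA; congr (_ * _).
    by apply/esym/center_Tr; apply: (divsubM dC).
  apply: big1_seq => r /andP [_ /Clk [Cr _]].
  have -> : \sum_(p <- q) p.1 * Tr (p.2 * r.1) = 0; last by rewrite !mul0r.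
  under eq_bigr => p _ do rewrite mulr_sumr.
  rewrite exchange_big /=; apply: big1_seq => w /andP [_ wws].
  under eq_bigr => p _ do rewrite conjrM ?(UM (wsM _ wws)) // mulrA.
  by rewrite -mulr_suml q0 // mul0r.
pose P d := \sum_(p <- lk) p.2 * d * p.1.
(* The tensor for [o P(d) - P(d) o] vanishes under each [w]: through the factor [o - w(o)] if [w]
   fixes [O], and through the dual family otherwise. *)
have CP d : C (P d).
  move=> o oO; have Co := OC o oO; apply/esym/eqP; rewrite -subr_eq0; apply/eqP.
  rewrite -[RHS](tensor0 ([seq (o * p.2, p.1) | p <- lk] ++ [seq (- p.2, p.1 * o) | p <- lk]) d).
  - rewrite big_cat !big_map /= mulr_sumr mulr_suml -sumrN; congr (_ + _).
      by apply: eq_bigr => p _; rewrite !mulrA.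
    by apply: eq_bigr => p _; rewrite !mulNr !mulrA.
  - move=> p; rewrite mem_cat => /orP [] /mapP [r /Clk [Cr1 Cr2] ->] //=.
    by apply: (divsubM dC) => //; apply: OC.
  move=> w wws; have Mw := wsM w wws; rewrite big_cat !big_map /= -big_split /=.
  have -> : \sum_(p <- lk) (o * p.2 * conjr w p.1 + - p.2 * conjr w (p.1 * o))
      = (o - conjr w o) * \sum_(p <- lk) conjr w p.1 * p.2.
    rewrite mulr_sumr big_seq [RHS]big_seq; apply: eq_bigr => p /Clk [C1 C2].
    have [Cw1 Cwo] : C (conjr w p.1) /\ C (conjr w o) by split; apply: nC.
    have e1 : p.2 * conjr w p.1 = conjr w p.1 * p.2 by apply: cC.
    have e2 : p.2 * (conjr w p.1 * conjr w o) = conjr w o * (conjr w p.1 * p.2).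
      by rewrite mulrA e1 (cC _ (conjr w o)) //; apply: (divsubM dC).
    by rewrite conjrM ?UM // mulrBl mulNr e2 -mulrA e1.
  have [e|nw] := EM {in O, conjr w =1 id}; first by rewrite e // subrr mul0r.
  by rewrite lk0' // mulr0.
(* Write 1 as the sum of the [Tr(l) k], and move the central traces past [k d]. *)
have PE d : d = \sum_(w <- ws) P (d * w) * w^-1.
  under eq_bigr => w _ do rewrite mulr_suml.
  rewrite exchange_big /= -{1}[d]mul1r (TrE 1 (divsub1 dC)) mulr_suml big_seq [RHS]big_seq.
  apply: eq_bigr => p /Clk [Cp _]; rewrite mul1r -mulrA center_Tr // /Tr mulr_sumr.
  by apply: eq_bigr => w _; rewrite /conjr !mulrA.
pose J := [seq (w, p) | w <- ws, p <- lk].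
apply: (@finite_dim_of_family _ J (fun wp : D * (D * D) => wp.2.2 * wp.1^-1) (1, (1, 1))) => d.
(* The default 0 keeps the coefficient central at indices outside [lk]. *)
exists (fun wp : D * (D * D) => if wp.2 \in lk then Tr (P (d * wp.1) * wp.2.1) else 0).
  case=> w p /=; case: ifP => [/Clk [Cp _]|_ y]; last by rewrite mul0r mulr0.
  by apply: center_Tr; apply: (divsubM dC).
rewrite /J big_allpairs /= {1}(PE d); apply: eq_bigr => w _.
rewrite {1}(TrE _ (CP (d * w))) mulr_suml big_seq [RHS]big_seq.
by apply: eq_bigr => p ->; rewrite mulrA.
Qed.

Lemma maximal_finite_dim : finite_dim_over_center D.
Proof.
apply: contrapT => nfd.
have genM : normal_subgroups_generate M.
  move=> N sN NM nN; have nR : normalized_by M (dgen N) by apply: dgen_normalized.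
  case: (maximal_normalized_division_subring maxM (dgen_division_subring N) nR) => [RM|allR|cR].
  - have cR := locally_solvable_division_subring_abelian (dgen_division_subring N) lsM algM RM.
    left=> x g Nx Mg; have dN := dgen_division_subring N.
    (* Such a displacement is a commutator in [M'], hence algebraic, and lies in the commutative
       [F(N)]; if noncentral it would give finite dimension. *)
    have disp m k : M m -> dgen N k -> k != 0 -> center (conjr m k * k^-1).
      move=> Mm Rk k0; apply: contrapT => nc; apply: nfd.
      apply: (finite_dim_of_abelian_normalized cR nR) nc; last first.
        apply: algM; have -> : conjr m k * k^-1 = commutator m^-1 k^-1.
          by rewrite /commutator !invrK.
        by apply: derived_commutator; apply: subgroupV => //; apply: RM.
      by apply: (divsubM dN); [apply: nR | apply: (divsubV dN)].
    have Ux := UM (NM _ Nx); have Ug := UM Mg; have Rx := dgen_sub Nx.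
    have x0 := unitr_neq0 Ux.
    case: (eqVneq (1 + x) 0) => [/eqP|x1].
      by rewrite addrC addr_eq0 => /eqP ->; rewrite mulNr mulrN mul1r mulr1.
    have R1x : dgen N (1 + x) by apply: (divsubD dN) => //; apply: (divsub1 dN).
    (* Let [g] multiply [x] by [c] and [1 + x] by [e], both central. Then [(e - c) x = 1 - e]:
       either [c = e = 1], or [x] is a quotient of central elements. *)
    have cc := disp g x Mg Rx x0; have cd := disp g (1 + x) Mg R1x x1.
    set c := conjr g x * x^-1 in cc; set e := conjr g (1 + x) * (1 + x)^-1 in cd.
    have cx : conjr g x = c * x by rewrite /c divrK.
    have e1x : (e - c) * x = 1 - e.
      have : conjr g (1 + x) = e * (1 + x) by rewrite /e divrK // hD.
      rewrite conjrD conjr_id // cx mulrDr mulr1 => h.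
      apply/eqP; rewrite mulrBl subr_eq addrAC eq_sym subr_eq h.
      by rewrite addrC.
    case: (eqVneq e c) => [ec|nec].
      move: e1x; rewrite ec subrr mul0r => /esym/eqP; rewrite subr_eq0 => /eqP c1.
      by apply/esym/conjr_fixP => //; rewrite cx -c1 mul1r.
    have Uec : e - c \is a GRing.unit by rewrite hD ?subr_eq0.
    have dF := cent_division_subring hD (fun y => y = g).
    rewrite -(mulKr Uec x) e1x.
    have Fe : cent (fun y => y = g) e by move=> _ ->; apply: cd.
    have Fc : cent (fun y => y = g) c by move=> _ ->; apply: cc.
    have : cent (fun y => y = g) ((e - c)^-1 * (1 - e)).
      apply: (divsubM dF); first by apply: (divsubV dF); apply: (divsubB dF).
      by apply: (divsubB dF) => //; apply: (divsub1 dF).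
    exact.
  - by right=> g _; apply: allR.
  - by left=> x g Nx _; apply: cR; apply: dgen_sub.
have [s [t [Ms Mt [s2 t2] [st nst] nQ]]] :=
  locally_solvable_quaternion hD sM lsM algM genM nabM'.
(* [M] normalizes the noncommutative [F(s, t)], which must therefore be [D]; so whatever commutes
   with [s] and [t] is central. *)
pose R := dgen (fun x => x \in quaternion_units s t).
have dR : division_subring R by apply: dgen_division_subring.
have Rs : R s by apply: dgen_sub; rewrite !inE eqxx.
have Rt : R t by apply: dgen_sub; rewrite !inE eqxx !orbT.
have nR : normalized_by M R by apply: dgen_normalized.
case: (maximal_normalized_division_subring maxM dR nR) => [RM|allR|cR].
- case/eqP: nst; exact: (locally_solvable_division_subring_abelian dR lsM algM RM).
- apply: nfd; apply: (quaternion_finite_dim hD s2 t2 st nst) => x xs xt y.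
  apply: (cent_dgen hD _ (allR y)) => z.
  by rewrite !inE; do ![case/predU1P=> [->|] | move/eqP=> ->];
    rewrite ?mulrN ?mulNr ?mulrA ?xs -?mulrA ?xt ?mulrA ?xs.
- by case/eqP: nst; apply: cR.
Qed.

End LocallySolvableMaximal.
End MaximalSubgroup.

Theorem theorem2p9 (D : unitRingType) (M : D -> Prop) :
  is_division_ring D -> noncommutative D ->
  maximal_subgroup M -> nonabelian M -> locally_solvable M ->
  set_algebraic_over_center (derived M) ->
  finite_dim_over_center D.
Proof. by move=> hD _ maxM nabM lsM algM; apply: maximal_finite_dim algM. Qed.
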